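(* Let $\epsilon\in(0,1)$ and $\delta\in(0,1)$. Then there exists a distribution over sparse matrices $\mathbf S\in\mathbb R^{r\times n}$ (an oblivious $\ell_1$ subspace embedding, i.e., its distribution does not depend on the input matrix) with \[ r=\mathrm{poly}(d,\epsilon^{-1},\delta^{-1},\log n)^{d/(\delta\epsilon)} \] (for some fixed polynomial) such that for any $\mathbf A\in\mathbb R^{n\times d}$, \[ \Pr_{\mathbf S}\Big\{\forall \mathbf x\in\mathbb R^d:\ (1-\epsilon)\|\mathbf A\mathbf x\|_1\le \|\mathbf S\mathbf A\mathbf x\|_1\le (1+\epsilon)\|\mathbf A\mathbf x\|_1\Big\}\ge 1-\delta . \]
   Context: $\|\cdot\|_1$ on vectors is the sum of absolute values of the coordinates. *)

(* Defs.v *)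
From HB Require Import structures.
From mathcomp Require Import all_boot all_order all_algebra.
From mathcomp Require Import all_classical all_reals all_analysis.
(* not Imported: the notations of mpoly clash with those of mathcomp-analysis *)
From mathcomp Require mpoly.

Set Implicit Arguments.
Unset Strict Implicit.
Unset Printing Implicit Defensive.

Import Order.TTheory GRing.Theory Num.Theory.
Import numFieldNormedType.Exports.

Local Open Scope classical_set_scope.
Local Open Scope ring_scope.

(* The library norm `|v| on matrices is the sup norm, hence a separate l1 norm. *)
Definition l1norm (R : realType) (m : nat) (v : 'cV[R]_m) : R :=
  \sum_(i < m) `|v i ord0|.

Notation borel_mx R r n := (g_sigma_algebraType (@open 'M[R]_(r, n))).

Definition col_sparse (R : realType) (r n : nat) (k : R) (S : 'M[R]_(r, n)) :
    Prop :=
  forall j : 'I_n, #|[set i : 'I_r | S i j != 0]%SET|%:R <= k.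

Definition l1_embeds (R : realType) (r n d : nat) (eps : R) (A : 'M[R]_(n, d))
    (S : 'M[R]_(r, n)) : Prop :=
  forall x : 'cV[R]_d,
    (1 - eps) * l1norm (A *m x) <= l1norm (S *m A *m x) /\
    l1norm (S *m A *m x) <= (1 + eps) * l1norm (A *m x).

Definition poly4 (R : realType) := mpoly.mpoly 4 R.

Definition eval4 (R : realType) (p : poly4 R) (a b c e : R) : R :=
  mpoly.meval (tnth [tuple a; b; c; e]) p.

(* Main.v *)
Require Import Defs.
From HB Require Import structures.
From mathcomp Require Import all_boot all_order all_algebra.
From mathcomp Require Import perm.
From mathcomp Require Import all_classical all_reals all_analysis.
From mathcomp Require Import (canonicals) mpoly.
From mathcomp Require Import ring lra zify.

(* Write the column space of [A] as the range of a near-Auerbach basis [U]: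
   columns of l1 norm at most 1 and [|x_j| <= 2 |U x|_1]. The row weights
   [w_i = |U_i|_1] add up to at most [d], so it suffices to compare [|S U x|_1]
   with [|U x|_1] up to [eps / 2] uniformly over the box [|x_j| <= 1].

   The sketch has about [ln n] levels. Level [h] keeps each row with probability
   [p_h = W^-c_h], hashes the kept rows into [p_h / p_(h+1)] buckets with random
   signs, and rescales by [1 / p_h]. At level [h], rows with [w_i] far above
   [p_h] survive with small probability; rows with [w_i] far below [p_(h+1)]
   cancel in their buckets thanks to the signs; rows far from both thresholds
   rarely collide and their sampled l1 mass concentrates uniformly in [x], by
   symmetrization and the contraction principle. All thresholds share a random
   shift [s < K] of the exponents [c_h = h K - s], and each row is within a
   factor poly([W]) of a threshold for at most 3 shifts out of [K], so that
   these boundary rows carry mass [O(d / K)] on average. With [K] of order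
   [d / (eps delta)] and [W] polynomial, Markov's inequality concludes. *)

Set Implicit Arguments.
Unset Strict Implicit.
Unset Printing Implicit Defensive.

Import Order.TTheory GRing.Theory Num.Theory.
Import numFieldNormedType.Exports.

Local Open Scope classical_set_scope.
Local Open Scope ring_scope.

(** * Averages over finite spaces *)

Section Average.
Variables (R : realFieldType) (T : finType).
Implicit Types f g : T -> R.

Definition avg f : R := (\sum_t f t) / #|T|%:R.

Lemma eq_avg f g : f =1 g -> avg f = avg g.
Proof. by move=> fg; congr (_ / _); apply: eq_bigr => t _; exact: fg. Qed.

Lemma ler_avg f g : (forall t, f t <= g t) -> avg f <= avg g.
Proof. by move=> fg; rewrite ler_wpM2r ?invr_ge0// ler_sum. Qed.

Lemma avg_ge0 f : (forall t, 0 <= f t) -> 0 <= avg f.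
Proof. by move=> f0; rewrite divr_ge0 ?sumr_ge0. Qed.

Lemma avgD f g : avg (fun t => f t + g t) = avg f + avg g.
Proof. by rewrite /avg big_split mulrDl. Qed.

Lemma avgN f : avg (fun t => - f t) = - avg f.
Proof. by rewrite /avg sumrN mulNr. Qed.

Lemma avgB f g : avg (fun t => f t - g t) = avg f - avg g.
Proof. by rewrite avgD avgN. Qed.

Lemma avgZl c f : avg (fun t => c * f t) = c * avg f.
Proof. by rewrite /avg -mulr_sumr mulrA. Qed.

Lemma avgZr c f : avg (fun t => f t * c) = avg f * c.
Proof. by rewrite /avg -mulr_suml mulrAC. Qed.

Lemma avg_sum (J : finType) (F : J -> T -> R) :
  avg (fun t => \sum_j F j t) = \sum_j avg (F j).
Proof. by rewrite /avg exchange_big mulr_suml. Qed.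

Lemma avg_exists_le (J : finType) (P : J -> pred T) :
  avg (fun t => [exists j, P j t]%:R) <= \sum_j avg (fun t => (P j t)%:R).
Proof.
rewrite -avg_sum; apply: ler_avg => t; case: existsP => [[j Pj]|_].
  by rewrite (bigD1 j)//= Pj lerDl sumr_ge0.
exact: sumr_ge0.
Qed.

Hypothesis T_gt0 : (0 < #|T|)%N.

Lemma avg_cst c : avg (fun=> c) = c.
Proof.
by rewrite /avg sumr_const -[X in X / _]mulr_natr mulfK// pnatr_eq0 -lt0n.
Qed.

Lemma avg_norm_le_sqr c f : 0 < c ->
  avg (fun t => `|f t|) <= (c * avg (fun t => f t ^+ 2) + c^-1) / 2.
Proof.
move=> c_gt0; rewrite -avgZl -(avg_cst c^-1) -avgD -avgZr.
apply: ler_avg => t; have : 0 <= c^-1 * (c * `|f t| - 1) ^+ 2.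
  by rewrite mulr_ge0 ?sqr_ge0// invr_ge0 ltW.
have -> : c^-1 * (c * `|f t| - 1) ^+ 2 = c * `|f t| ^+ 2 - 2 * `|f t| + c^-1.
  by field; rewrite gt_eqF.
by rewrite real_normK ?num_real//; lra.
Qed.

End Average.

Section AveragePair.
Variables (R : realFieldType) (T S : finType).

Lemma avg_pair (f : T * S -> R) :
  avg f = avg (fun t => avg (fun s => f (t, s))).
Proof.
rewrite /avg -mulr_suml (pair_big xpredT xpredT (fun t s => f (t, s)))/=.
rewrite card_prod natrM invfM -mulrA [in RHS](mulrC #|S|%:R^-1).
by congr (_ * _); apply: eq_bigr => -[].
Qed.

Lemma avg_mul (f : T -> R) (g : S -> R) :
  avg (fun u => f u.1 * g u.2) = avg f * avg g.
Proof. by rewrite avg_pair -avgZr; apply: eq_avg => t; rewrite /= avgZl. Qed.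

Lemma avg_fst (f : T -> R) : (0 < #|S|)%N ->
  avg (fun u : T * S => f u.1) = avg f.
Proof.
by move=> S_gt0; rewrite avg_pair; apply: eq_avg => t; rewrite /= avg_cst.
Qed.

Lemma avg_snd (g : S -> R) : (0 < #|T|)%N ->
  avg (fun u : T * S => g u.2) = avg g.
Proof. by move=> T_gt0; rewrite avg_pair /= avg_cst. Qed.

End AveragePair.

Section ProductSpace.
Variables (R : realFieldType) (I D : finType).
Hypothesis D_gt0 : (0 < #|D|)%N.
Local Notation Omega := {ffun I -> D}.

Lemma card_ffun_gt0 : (0 < #|Omega|)%N.
Proof. by rewrite card_ffun expn_gt0 D_gt0. Qed.

Lemma avg_prod (F : I -> D -> R) :
  avg (fun w : Omega => \prod_i F i (w i)) = \prod_i avg (F i).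
Proof.
rewrite /avg -bigA_distr_bigA/= big_split/=; congr (_ * _).
by rewrite prodr_const card_ffun natrX exprVn.
Qed.

Lemma avg_coord2 i j (g h : D -> R) : i != j ->
  avg (fun w : Omega => g (w i) * h (w j)) = avg g * avg h.
Proof.
move=> ij; pose only (k : I) (f : D -> R) l d := if l == k then f d else 1.
have only_avg k f l :
    avg (only k f l) = if l == k then avg f else 1.
  by rewrite /only; case: ifP => // _; rewrite avg_cst.
transitivity (\prod_l avg (fun d => only i g l d * only j h l d)).
  rewrite -avg_prod; apply: eq_avg => w.
  by rewrite big_split/= -!big_mkcond !big_pred1_eq.
rewrite (eq_bigr (fun l => avg (only i g l) * avg (only j h l))).
  by rewrite big_split/= !(eq_bigr _ (fun l _ => only_avg _ _ l)) -!big_mkcond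
    !big_pred1_eq.
move=> l _; rewrite !only_avg /only; have [->|li] := eqVneq l i.
  by rewrite (negPf ij) avgZr.
by rewrite avgZl !mul1r; case: ifP; rewrite ?avg_cst.
Qed.

Lemma avg_coord i (g : D -> R) : avg (fun w : Omega => g (w i)) = avg g.
Proof.
transitivity (\prod_l avg (fun d => if l == i then g d else 1)).
  by rewrite -avg_prod; apply: eq_avg => w; rewrite -big_mkcond big_pred1_eq.
rewrite (bigD1 i)//= big1 => [|l /negPf->]; last by rewrite avg_cst.
by rewrite eqxx mulr1.
Qed.

Lemma avg_sqr_sum (z : I -> D -> R) : (forall i, avg (z i) = 0) ->
  avg (fun w : Omega => (\sum_i z i (w i)) ^+ 2)
  = \sum_i avg (fun d => z i d ^+ 2).
Proof.
move=> z_centered.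
rewrite (eq_avg (g := fun w : Omega => \sum_i \sum_j z i (w i) * z j (w j))).
  rewrite avg_sum; apply: eq_bigr => i _.
  rewrite avg_sum (bigD1 i)//= big1 => [|j ji].
    by rewrite addr0 -(avg_coord i (fun d => z i d ^+ 2)).
  by rewrite avg_coord2 1?eq_sym// z_centered mul0r.
by move=> w; rewrite expr2 mulr_suml; apply: eq_bigr => i _; rewrite mulr_sumr.
Qed.

End ProductSpace.

(** * Expected suprema *)

Section ExpectedSupremum.
Variables (R : realFieldType) (X : Type) (S : X -> Prop).

(* The average of [sup_(x in S) F t x] is at most [c]. Quantifying over the
   selections [x] of near-maximizers avoids the existence of the supremum. *)
Definition avg_sup_le (T : finType) (F : T -> X -> R) (c : R) :=
  forall x : T -> X, (forall t, S (x t)) -> avg (fun t => F t (x t)) <= c.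

Section FixedSpace.
Variable T : finType.
Implicit Types F G : T -> X -> R.

Lemma avg_sup_leW F G c : (forall t x, S x -> F t x <= G t x) ->
  avg_sup_le G c -> avg_sup_le F c.
Proof.
by move=> FG Gc x Sx; apply: le_trans (Gc x Sx); apply: ler_avg => t; exact: FG.
Qed.

Lemma eq_avg_sup_le F G c : F =2 G -> avg_sup_le G c -> avg_sup_le F c.
Proof. by move=> FG; apply: avg_sup_leW => t x _; rewrite FG. Qed.

Lemma avg_sup_le_cst (f : T -> R) : avg_sup_le (fun t _ => f t) (avg f).
Proof. by move=> x _. Qed.

Lemma avg_sup_leD F G c d : avg_sup_le F c -> avg_sup_le G d ->
  avg_sup_le (fun t x => F t x + G t x) (c + d).
Proof. by move=> Fc Gd x Sx; rewrite avgD lerD ?Fc ?Gd. Qed.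

Lemma avg_sup_le_sum (J : finType) (F : J -> T -> X -> R) (c : J -> R) :
  (forall j, avg_sup_le (F j) (c j)) ->
  avg_sup_le (fun t x => \sum_j F j t x) (\sum_j c j).
Proof. by move=> Fc x Sx; rewrite avg_sum ler_sum// => j _; exact: Fc. Qed.

Lemma avg_sup_le_norm F c d x0 : S x0 -> (forall t, F t x0 = 0) ->
  avg_sup_le F c -> avg_sup_le (fun t x => - F t x) d ->
  avg_sup_le (fun t x => `|F t x|) (c + d).
Proof.
move=> Sx0 F0 Fc Fd x Sx; pose nonneg t := 0 <= F t (x t).
pose xpos t := if nonneg t then x t else x0.
pose xneg t := if nonneg t then x0 else x t.
have Sxpos t : S (xpos t) by rewrite /xpos; case: ifP.
have Sxneg t : S (xneg t) by rewrite /xneg; case: ifP.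
apply: le_trans (lerD (Fc _ Sxpos) (Fd _ Sxneg)); rewrite -avgD.
apply: ler_avg => t; rewrite /xpos /xneg; case: ifP => [Fx|/negbT].
  by rewrite F0 subr0 ger0_norm.
by rewrite /nonneg -ltNge => Fx; rewrite F0 add0r ltr0_norm.
Qed.

(* Markov's inequality, applied to a selection of witnesses of failure. *)
Lemma avg_sup_le_markov F c e : 0 < e -> (exists x, S x) ->
  (forall t x, 0 <= F t x) -> avg_sup_le F c ->
  avg (fun t => (~~ `[< forall x, S x -> F t x <= e >])%:R) <= c / e.
Proof.
move=> e_gt0 [x0 Sx0] F0 Fc.
have /choice[x xP] t : exists x, S x /\
    (~~ `[< forall x, S x -> F t x <= e >] -> e < F t x).
  have [_|nF] := asboolP (forall x, S x -> F t x <= e).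
    by exists x0.
  apply: contrapT => nx; apply: nF => x Sx; rewrite leNgt; apply/negP => Fx.
  by apply: nx; exists x.
rewrite ler_pdivlMr// -avgZr; apply: le_trans (Fc x _) => [|t].
  apply: ler_avg => t; have [_] := xP t; case: (~~ _) => [Fx|_].
    by rewrite mul1r ltW// Fx.
  by rewrite mul0r.
by have [] := xP t.
Qed.

End FixedSpace.

Lemma avg_sup_le_pair (T T' : finType) (F : T * T' -> X -> R) (c : T -> R) :
  (forall t, avg_sup_le (fun t' => F (t, t')) (c t)) -> avg_sup_le F (avg c).
Proof.
move=> Fc x Sx; rewrite avg_pair; apply: ler_avg => t.
exact: (Fc t (fun t' => x (t, t'))).
Qed.

End ExpectedSupremum.

Section Contraction.
Variables (R : realFieldType) (X : Type) (S : X -> Prop) (T : finType).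

(* Choosing well between [x t] and [x (s t)] turns the difference of the values
   of [y] into its absolute value, which bounds the difference of the [`|y|]. *)
Lemma contraction_one_term (s : T -> T) (a : T -> R) (g : T -> X -> R)
    (y : X -> R) c :
  involutive s -> (forall t, a (s t) = - a t) -> (forall t, g (s t) =1 g t) ->
  avg_sup_le S (fun t x => g t x + a t * y x) c ->
  avg_sup_le S (fun t x => g t x + a t * `|y x|) c.
Proof.
move=> sK sa sg gyc x Sx.
pose keep t := 0 <= a t * (y (x t) - y (x (s t))).
have keeps t : keep (s t) = keep t by rewrite /keep sa sK mulNr -mulrN opprB.
pose x' t := if keep t then x t else x (s t).
apply: le_trans (gyc x' _) => [|t]; last by rewrite /x'; case: ifP.
have dbl (F : T -> R) : \sum_t F t *+ 2 = \sum_t (F t + F (s t)).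
  rewrite sumrMnl mulr2n big_split/= [X in _ = _ + X](reindex_inj (inv_inj sK)).
  by congr (_ + _); apply: eq_bigr => t _; rewrite sK.
rewrite ler_wpM2r ?invr_ge0// -(ler_pMn2r (n := 2))// -!sumrMnl !dbl.
apply: ler_sum => t _; rewrite /x' keeps sK !sa !sg.
have : a t * `|y (x t)| - a t * `|y (x (s t))|
       <= `|a t * (y (x t) - y (x (s t)))|.
  rewrite -mulrBr normrM; apply: le_trans (ler_norm _) _.
  by rewrite normrM ler_wpM2l// ler_dist_dist.
case: (boolP (keep t)) => [keept|]; first by rewrite (ger0_norm keept); lra.
by rewrite /keep -ltNge => /ltr0_norm->; lra.
Qed.

Lemma contraction (I : finType) (s : I -> T -> T) (a : I -> T -> R)
    (y : I -> X -> R) c :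
  (forall i, involutive (s i)) ->
  (forall i t, a i (s i t) = - a i t) ->
  (forall i j t, j != i -> a j (s i t) = a j t) ->
  avg_sup_le S (fun t x => \sum_i a i t * y i x) c ->
  avg_sup_le S (fun t x => \sum_i a i t * `|y i x|) c.
Proof.
move=> sK sa saj yc.
pose F (r : seq I) i x := if i \in r then `|y i x| else y i x.
suff Fc r : uniq r -> avg_sup_le S (fun t x => \sum_i a i t * F r i x) c.
  apply: eq_avg_sup_le (Fc _ (enum_uniq I)) => t x.
  by apply: eq_bigr => i _; rewrite /F mem_enum.
elim: r => [//|i r IH].
move=> /= /andP[ir ur].
pose g t x := \sum_(j | j != i) a j t * F r j x.
have sg t : g (s i t) =1 g t by move=> x; apply: eq_bigr => j ji; rewrite saj.
have gyc : avg_sup_le S (fun t x => g t x + a i t * y i x) c.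
  apply: eq_avg_sup_le (IH ur) => t x.
  by rewrite [RHS](bigD1 i)//= addrC {2}/F (negPf ir).
apply: eq_avg_sup_le (contraction_one_term (sK i) (sa i) sg gyc) => t x.
rewrite (bigD1 i)//= addrC /F in_cons eqxx; congr (_ + _).
by apply: eq_bigr => j ji; rewrite in_cons (negPf ji).
Qed.

End Contraction.

Section Symmetrization.
Variables (R : realFieldType) (X : Type) (S : X -> Prop) (I D : finType).
Variables (z : I -> D -> R) (y : I -> X -> R) (c : R).
Hypotheses (D_gt0 : (0 < #|D|)%N) (z_centered : forall i, avg (z i) = 0).
Local Notation Omega := {ffun I -> D}.

Lemma symmetrization :
  avg_sup_le S (fun (t : Omega * Omega) x =>
    \sum_i (z i (t.1 i) - z i (t.2 i)) * y i x) c ->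
  avg_sup_le S (fun (w : Omega) x => \sum_i z i (w i) * y i x) c.
Proof.
move=> yc x Sx; apply: le_trans (yc (fun t => x t.1) (fun t => Sx t.1)).
rewrite avg_pair; apply: ler_avg => w.
rewrite avg_sum; apply: ler_sum => i _/=.
by rewrite avgZr avgB avg_cst ?card_ffun_gt0// avg_coord// z_centered subr0.
Qed.

End Symmetrization.

(* Swapping the [i]-th coins of a sample and its ghost copy flips the sign of
   the [i]-th coefficient only, which makes the contraction applicable. *)
Lemma symmetrized_contraction (R : realFieldType) (X : Type) (S : X -> Prop)
    (I D : finType) (z : I -> D -> R) (y : I -> X -> R) (c : R) :
  (0 < #|D|)%N -> (forall i, avg (z i) = 0) ->
  avg_sup_le S (fun (t : {ffun I -> D} * {ffun I -> D}) x =>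
    \sum_i (z i (t.1 i) - z i (t.2 i)) * y i x) c ->
  avg_sup_le S (fun (w : {ffun I -> D}) x => \sum_i z i (w i) * `|y i x|) c.
Proof.
move=> D_gt0 z_centered yc; apply: symmetrization => //.
pose upd i (w w' : {ffun I -> D}) := [ffun j => if j == i then w' j else w j].
pose swap i (t : {ffun I -> D} * {ffun I -> D}) :=
  (upd i t.1 t.2, upd i t.2 t.1).
apply: (contraction (s := swap)) yc => [i [w w']|i t|i j t /negPf ji].
- by congr (_, _); apply/ffunP => j; rewrite !ffunE/= ?ffunE; case: eqP.
- by rewrite !ffunE eqxx opprB.
- by rewrite !ffunE ji.
Qed.

(** * Suprema over the range of a matrix with small rows *)

Section RowWeights.
Variables (R : realFieldType) (n k : nat).
Implicit Types (U : 'M[R]_(n, k)) (x : 'cV[R]_k).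

Definition box x := forall j, `|x j ord0| <= 1.

Definition short_columns U := forall j, \sum_i `|U i j| <= 1.

Definition weight U i : R := \sum_j `|U i j|.

Lemma box0 : box 0.
Proof. by move=> j; rewrite mxE normr0. Qed.

Lemma weight_ge0 U i : 0 <= weight U i.
Proof. exact: sumr_ge0. Qed.

Lemma ler_norm_weight U i j : `|U i j| <= weight U i.
Proof. by rewrite /weight (bigD1 j)//= lerDl sumr_ge0. Qed.

Lemma sum_weight_le U : short_columns U -> \sum_i weight U i <= k%:R.
Proof.
move=> U_short; rewrite exchange_big/=.
apply: le_trans (ler_sum _ (fun j _ => U_short j)) _.
by rewrite sumr_const card_ord.
Qed.

Lemma norm_mulmx_le_weight U x i : box x -> `|(U *m x) i ord0| <= weight U i.
Proof.
move=> x_box; rewrite mxE; apply: le_trans (ler_norm_sum _ _ _) _.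
by apply: ler_sum => j _; rewrite normrM ler_piMr.
Qed.

Lemma norm_sum_mulmx_le U x (a : 'I_n -> R) : box x ->
  `|\sum_i a i * (U *m x) i ord0| <= \sum_j `|\sum_i a i * U i j|.
Proof.
move=> x_box.
have -> : \sum_i a i * (U *m x) i ord0 = \sum_j (\sum_i a i * U i j) * x j ord0.
  under [RHS]eq_bigr do rewrite mulr_suml.
  rewrite exchange_big; apply: eq_bigr => i _.
  by rewrite mxE mulr_sumr; apply: eq_bigr => j _; rewrite mulrA.
apply: le_trans (ler_norm_sum _ _ _) _.
by apply: ler_sum => j _; rewrite normrM ler_piMr.
Qed.

End RowWeights.

Section LinearSampling.
Variables (R : realFieldType) (n k : nat) (U : 'M[R]_(n, k)).
Variables (D : finType) (V : R).
Hypotheses (U_short : short_columns U) (D_gt0 : (0 < #|D|)%N) (V_gt0 : 0 < V).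
Local Notation Omega := {ffun 'I_n -> D}.

Section Buckets.
Variables (B : finType) (z : B -> 'I_n -> D -> R).
Hypotheses (B_gt0 : (0 < #|B|)%N) (z_centered : forall b i, avg (z b i) = 0).
Hypothesis z_small : forall i,
  #|B|%:R * (\sum_b avg (fun d => z b i d ^+ 2)) * weight U i <= V ^- 2.

Lemma avg_sum_norm_column_le j :
  avg (fun w : Omega => \sum_b `|\sum_i z b i (w i) * U i j|) <= V^-1.
Proof.
set N : R := #|B|%:R; have N_gt0 : 0 < N by rewrite ltr0n.
pose var b i := avg (fun d => z b i d ^+ 2).
have bucket_le b : avg (fun w : Omega => `|\sum_i z b i (w i) * U i j|)
    <= (N * V * (\sum_i var b i * U i j ^+ 2) + (N * V)^-1) / 2.
  have NV_gt0 : 0 < N * V by rewrite mulr_gt0.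
  apply: le_trans (avg_norm_le_sqr (card_ffun_gt0 _ D_gt0) _ NV_gt0) _.
  rewrite (avg_sqr_sum D_gt0 (z := fun i d => z b i d * U i j)) => [|i].
    rewrite ler_wpM2r// lerD2r ler_wpM2l ?(ltW NV_gt0)//; apply: ler_sum => i _.
    by rewrite -avgZr; apply: ler_avg => d; rewrite exprMn.
  by rewrite avgZr z_centered mul0r.
have var_le : \sum_i N * (\sum_b var b i) * U i j ^+ 2 <= V ^- 2.
  apply: le_trans (_ : \sum_i V ^- 2 * `|U i j| <= _); last first.
    by rewrite -mulr_sumr ler_piMr ?U_short// -exprVn sqr_ge0.
  apply: ler_sum => i _.
  rewrite -real_normK ?num_real// expr2 mulrA ler_wpM2r//.
  apply: le_trans (z_small i); rewrite ler_wpM2l ?ler_norm_weight//.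
  rewrite mulr_ge0 ?sumr_ge0// => b _; apply: avg_ge0 => d; exact: sqr_ge0.
rewrite avg_sum; apply: le_trans (ler_sum _ (fun b _ => bucket_le b)) _.
rewrite -mulr_suml big_split/= sumr_const -mulr_sumr -[X in _ + X]mulr_natl.
have -> : \sum_b \sum_i var b i * U i j ^+ 2
    = \sum_i (\sum_b var b i) * U i j ^+ 2.
  by rewrite exchange_big; apply: eq_bigr => i _; rewrite mulr_suml.
move: var_le; rewrite -/N [(N * V)^-1]invfM mulVKf ?gt_eqF//.
under eq_bigr do rewrite -mulrA.
rewrite -mulr_sumr => /(ler_wpM2l (ltW V_gt0)).
have -> : V * V ^- 2 = V^-1 by field; rewrite gt_eqF.
lra.
Qed.

Lemma avg_sum_norm_columns_le :
  avg (fun w : Omega => \sum_j \sum_b `|\sum_i z b i (w i) * U i j|)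
  <= k%:R / V.
Proof.
rewrite avg_sum.
apply: le_trans (ler_sum _ (fun j _ => avg_sum_norm_column_le j)) _.
by rewrite sumr_const card_ord -[leLHS]mulr_natl.
Qed.

Lemma avg_sup_linear_le :
  avg_sup_le (@box R k)
    (fun (w : Omega) x => \sum_b `|\sum_i z b i (w i) * (U *m x) i ord0|)
    (k%:R / V).
Proof.
move=> x x_box; apply: le_trans avg_sum_norm_columns_le; apply: ler_avg => w.
by rewrite exchange_big/=; apply: ler_sum => b _; exact: norm_sum_mulmx_le.
Qed.

End Buckets.

Lemma avg_sup_sum_norm_le (z : 'I_n -> D -> R) : (forall i, avg (z i) = 0) ->
  (forall i, avg (fun d => z i d ^+ 2) * weight U i <= V ^- 2) ->
  avg_sup_le (@box R k)
    (fun (w : Omega) x => \sum_i z i (w i) * `|(U *m x) i ord0|) (2 * k%:R / V).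
Proof.
move=> z_centered z_small; apply: symmetrized_contraction => //.
pose Z (w : Omega) := \sum_j \sum_(b : unit) `|\sum_i z i (w i) * U i j|.
have Z_le : avg Z <= k%:R / V.
  apply: (avg_sum_norm_columns_le (z := fun _ => z)) => [|//|i];
    rewrite card_unit//.
  by rewrite mul1r big_const card_unit/= addr0.
have Omega_gt0 := card_ffun_gt0 'I_n D_gt0.
have -> : 2 * k%:R / V = k%:R / V + k%:R / V by ring.
move=> x x_box; apply: le_trans (lerD Z_le Z_le).
rewrite -[X in X + _](avg_fst Z Omega_gt0).
rewrite -[X in _ + X](avg_snd Z Omega_gt0) -avgD.
apply: ler_avg => t.
under eq_bigr do rewrite mulrBl.
rewrite sumrB; apply: le_trans (ler_norm _) _.
apply: le_trans (ler_normB _ _) _.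
have Z_ge (w : Omega) : `|\sum_i z i (w i) * (U *m x t) i ord0| <= Z w.
  apply: le_trans (norm_sum_mulmx_le _ _ (x_box t)) _; apply: ler_sum => j _.
  by rewrite big_const card_unit/= addr0.
by rewrite lerD.
Qed.

Lemma avg_sup_norm_sum_norm_le (z : 'I_n -> D -> R) :
  (forall i, avg (z i) = 0) ->
  (forall i, avg (fun d => z i d ^+ 2) * weight U i <= V ^- 2) ->
  avg_sup_le (@box R k)
    (fun (w : Omega) x => `|\sum_i z i (w i) * `|(U *m x) i ord0| |)
    (4 * k%:R / V).
Proof.
move=> z_centered z_small.
have -> : 4 * k%:R / V = 2 * k%:R / V + 2 * k%:R / V by field; rewrite gt_eqF.
apply: (avg_sup_le_norm (@box0 R k)) => [w||].
- by rewrite big1// => i _; rewrite mulmx0 mxE normr0 mulr0.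
- exact: avg_sup_sum_norm_le.
- apply: avg_sup_leW (avg_sup_sum_norm_le (z := fun i d => - z i d) _ _) =>
    [w x _|i|i].
  + by rewrite -sumrN; apply: ler_sum => i _; rewrite mulNr.
  + by rewrite avgN z_centered oppr0.
  + by under eq_avg do rewrite sqrrN; exact: z_small.
Qed.

End LinearSampling.

(** * One level of the sketch *)

Lemma sum_norm_sub_norm_sum_le (R : realFieldType) (I : finType) (y : I -> R) :
  \sum_i `|y i| - `|\sum_i y i|
  <= \sum_i `|y i| * \sum_(j | j != i) (y j != 0)%:R.
Proof.
have [/existsP[i /forall_inP yi]|] :=
    boolP [exists i, [forall (j | j != i), y j == 0]].
  have y0 j : j != i -> y j = 0 by move=> ji; apply/eqP; exact: yi.
  rewrite (bigD1 i)//= big1 => [|j ji]; last by rewrite y0// normr0.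
  rewrite [\sum_i y i](bigD1 i)//= [X in `|_ + X|]big1 => [|j /y0//].
  by rewrite !addr0 subrr sumr_ge0// => j _; rewrite mulr_ge0// sumr_ge0.
rewrite negb_exists => /forallP others.
apply: (@le_trans _ _ (\sum_i `|y i|)); first by rewrite gerBl.
apply: ler_sum => i _; rewrite ler_peMr//.
have := others i; rewrite negb_forall_in => /exists_inP[j ji yj].
by rewrite (bigD1 j)//= yj lerDl sumr_ge0.
Qed.

Section LevelNorm.
Variables (R : realFieldType) (n : nat) (D1 D2 B : finType).
Variables (kept : pred D1) (bucket : D2 -> B).
Local Notation coin := (D1 * D2 * bool)%type.
Local Notation Omega := {ffun 'I_n -> coin}.
Implicit Types (d : coin) (w : Omega) (v : 'I_n -> R) (P : pred 'I_n).

Definition keep_prob : R := avg (fun a => (kept a)%:R).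
Local Notation p := keep_prob.

Definition hits b d := kept d.1.1 && (bucket d.1.2 == b).

Definition level_entry b d : R := (hits b d)%:R / p * (-1) ^+ d.2.

Definition keep_scale d : R := (kept d.1.1)%:R / p.

Definition level_norm w v : R := \sum_b `|\sum_i level_entry b (w i) * v i|.

Definition common_hits w i j : R :=
  \sum_b (hits b (w i))%:R * (hits b (w j))%:R.

Definition mask P v i : R := (P i)%:R * v i.

Definition heavy_kept P w := [exists i, P i && kept (w i).1.1].

Hypothesis p_gt0 : 0 < p.

Lemma keep_space_gt0 : (0 < #|D1|)%N.
Proof.
rewrite lt0n; apply/eqP => D1_0; move: p_gt0.
by rewrite /keep_prob /avg D1_0 invr0 mulr0 ltxx.
Qed.

Lemma sum_hits d : \sum_b (hits b d)%:R = (kept d.1.1)%:R :> R.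
Proof.
rewrite (bigD1 (bucket d.1.2))//= big1 ?addr0 => [|b bb].
  by rewrite /hits eqxx andbT.
by rewrite /hits eq_sym (negPf bb) andbF.
Qed.

Lemma keep_scale_ge0 d : 0 <= keep_scale d.
Proof. by rewrite divr_ge0// ltW. Qed.

Lemma norm_level_entry b d : `|level_entry b d| = (hits b d)%:R / p.
Proof.
by rewrite normrM normr_sign mulr1 ger0_norm// divr_ge0// ltW.
Qed.

Lemma sum_norm_level_entry d : \sum_b `|level_entry b d| = keep_scale d.
Proof.
by rewrite (eq_bigr _ (fun b _ => norm_level_entry b d)) -mulr_suml sum_hits.
Qed.

Lemma sum_norm_level_terms w v :
  \sum_b \sum_i `|level_entry b (w i) * v i| = \sum_i keep_scale (w i) * `|v i|.
Proof.
rewrite exchange_big; apply: eq_bigr => i _.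
rewrite -sum_norm_level_entry mulr_suml.
by apply: eq_bigr => b _; rewrite normrM.
Qed.

Lemma level_norm_ge0 w v : 0 <= level_norm w v.
Proof. exact: sumr_ge0. Qed.

Lemma level_norm_le w v : level_norm w v <= \sum_i keep_scale (w i) * `|v i|.
Proof.
by rewrite -sum_norm_level_terms; apply: ler_sum => b _; exact: ler_norm_sum.
Qed.

Lemma ler_dist_level_norm w u v :
  `|level_norm w (fun i => u i + v i) - level_norm w u| <= level_norm w v.
Proof.
rewrite /level_norm -sumrB; apply: le_trans (ler_norm_sum _ _ _) _.
apply: ler_sum => b _; under eq_bigr do rewrite mulrDr.
rewrite big_split/=; apply: le_trans (ler_dist_dist _ _) _.
by rewrite addrAC subrr add0r.
Qed.

Lemma level_norm_split (G L : pred 'I_n) w v : (forall i, ~~ (G i && L i)) ->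
  `|level_norm w v - \sum_i (G i)%:R * `|v i| |
  <= \sum_i (~~ (G i || L i))%:R * (keep_scale (w i) * `|v i|)
     + level_norm w (mask L v)
     + `|level_norm w (mask G v)
         - \sum_i keep_scale (w i) * ((G i)%:R * `|v i|)|
     + `|\sum_i (G i)%:R * (keep_scale (w i) - 1) * `|v i| |.
Proof.
move=> GL; pose rest i := ~~ (G i || L i).
pose u i := mask G v i + mask L v i.
have vE : v = fun i => u i + mask rest v i.
  apply/funext => i; have := GL i; rewrite /u /mask /rest.
  by case: (G i) (L i) => -[]//= _; rewrite ?mul1r ?mul0r ?add0r ?addr0.
have dist_rest := ler_dist_level_norm w u (mask rest v).
have dist_L := ler_dist_level_norm w (mask G v) (mask L v).
rewrite -vE -/u in dist_rest dist_L.
have rest_le : level_norm w (mask rest v)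
    <= \sum_i (rest i)%:R * (keep_scale (w i) * `|v i|).
  apply: le_trans (level_norm_le _ _) _; apply: ler_sum => i _.
  by rewrite normrM normr_nat mulrCA.
set c := \sum_i (G i)%:R * _; set c' := \sum_i keep_scale _ * _.
have -> : \sum_i (G i)%:R * (keep_scale (w i) - 1) * `|v i| = c' - c.
  by rewrite -sumrB; apply: eq_bigr => i _; ring.
rewrite [level_norm w v - c](_ : _ = level_norm w v - level_norm w u
  + (level_norm w u - level_norm w (mask G v))
  + (level_norm w (mask G v) - c') + (c' - c)); last by ring.
do 2![apply: le_trans (ler_normD _ _) _; rewrite lerD2r].
by apply: le_trans (ler_normD _ _) _; rewrite lerD// (le_trans dist_rest).
Qed.

Lemma level_norm_collisions P w v :
  `|level_norm w (mask P v) - \sum_i keep_scale (w i) * ((P i)%:R * `|v i|)|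
  <= \sum_i \sum_(j | j != i)
       (P i)%:R * `|v i| / p * ((P j)%:R * common_hits w i j).
Proof.
have -> : \sum_i keep_scale (w i) * ((P i)%:R * `|v i|)
    = \sum_i keep_scale (w i) * `|mask P v i|.
  by apply: eq_bigr => i _; rewrite normrM normr_nat.
rewrite ler0_norm ?subr_le0 ?level_norm_le// opprB.
rewrite -sum_norm_level_terms -sumrB.
apply: le_trans (ler_sum _ (fun b _ => sum_norm_sub_norm_sum_le _)) _.
rewrite exchange_big/=; apply: ler_sum => i _.
under eq_bigr do rewrite mulr_sumr.
rewrite exchange_big/=; apply: ler_sum => j _; rewrite !mulr_sumr.
apply: ler_sum => b _; rewrite normrM norm_level_entry normrM normr_nat.
rewrite [leRHS](_ : _ = (hits b (w i))%:R / p * ((P i)%:R * `|v i|)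
  * ((P j)%:R * (hits b (w j))%:R)); last by ring.
rewrite ler_wpM2l ?mulr_ge0 ?invr_ge0 ?(ltW p_gt0) ?mulr_ge0//.
rewrite -natrM mulnb ler_nat.
rewrite /level_entry /mask; case: (P j); last by rewrite mul0r mulr0 eqxx.
by case: (hits b (w j)); rewrite ?leq_b1// !mul0r eqxx.
Qed.

Lemma avg_kept : (0 < #|D2|)%N -> avg (fun d => (kept d.1.1)%:R) = p.
Proof.
move=> D2_gt0.
rewrite (avg_fst (fun u : D1 * D2 => (kept u.1)%:R)) ?card_bool//.
exact: (avg_fst (fun a => (kept a)%:R)).
Qed.

Lemma avg_keep_scale : (0 < #|D2|)%N -> avg keep_scale = 1.
Proof. by move=> D2_gt0; rewrite avgZr avg_kept// mulfV// gt_eqF. Qed.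

Lemma avg_sqr_keep_scale : (0 < #|D2|)%N ->
  avg (fun d => (keep_scale d - 1) ^+ 2) = p^-1 - 1.
Proof.
move=> D2_gt0.
have coin_gt0 : (0 < #|{: coin}|)%N.
  by rewrite !card_prod card_bool !muln_gt0 keep_space_gt0 D2_gt0.
rewrite (eq_avg (g := fun d => keep_scale d * (p^-1 - 2) + 1)) => [|d].
  by rewrite avgD avgZr avg_keep_scale// avg_cst//; lra.
by rewrite /keep_scale; case: (kept _) => /=; ring.
Qed.

Lemma avg_hits b : avg (fun d => (hits b d)%:R)
  = p * avg (fun a => (bucket a == b)%:R) :> R.
Proof.
rewrite (avg_fst (fun u : D1 * D2 => (kept u.1 && (bucket u.2 == b))%:R))
  ?card_bool//.
by rewrite -avg_mul; apply: eq_avg => u; rewrite -natrM mulnb.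
Qed.

Lemma avg_level_entry b : avg (level_entry b) = 0.
Proof.
rewrite (avg_mul (fun u : D1 * D2 => (kept u.1 && (bucket u.2 == b))%:R / p)
  (fun s : bool => (-1) ^+ s)).
by rewrite [X in _ * X]/avg big_bool/= addNr mul0r mulr0.
Qed.

Lemma sum_avg_sqr_level_entry : (0 < #|D2|)%N ->
  \sum_b avg (fun d => level_entry b d ^+ 2) = p^-1.
Proof.
move=> D2_gt0; rewrite -avg_sum (eq_avg (g := fun d => keep_scale d * p^-1)).
  by rewrite avgZr avg_keep_scale// mul1r.
move=> d; rewrite -sum_norm_level_entry mulr_suml; apply: eq_bigr => b _.
rewrite -real_normK ?num_real// norm_level_entry.
by case: (hits b d); rewrite ?mul0r ?expr0n// mul1r expr2.
Qed.

End LevelNorm.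

Section WeightRegimes.
Variables (R : realFieldType) (V : R).
Implicit Types p q t u : R.

(* How a level that keeps rows with probability [p] and hashes them into [p / q]
   buckets treats a row of weight [u]: [q] is the probability of the next level,
   and rows within a factor poly([V]) of [p] or [q] are not under control. *)
Definition heavy p u := (p < 1) && (p * V < u).
Definition good p q u := (q * V < u) && ((p == 1) || (u <= p / V ^+ 2)).
Definition light q u := u <= q / V ^+ 2.
Definition near t u := t / V ^+ 2 < u <= t * V.

Hypothesis V_gt1 : 1 < V.

Lemma divV2_le t : 0 <= t -> t / V ^+ 2 <= t * V.
Proof.
move=> t_ge0; have V_gt0 : 0 < V by exact: lt_trans V_gt1.
rewrite ler_wpM2l// (@le_trans _ _ 1)// ?(ltW V_gt1)//.
by rewrite invf_le1 ?exprn_gt0// exprn_ege1// ltW.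
Qed.

Lemma good_light_disjoint p q u : 0 <= q -> ~~ (good p q u && light q u).
Proof.
move=> q_ge0; apply/negP => /andP[/andP[qu _]]; rewrite /light => uq.
by have := divV2_le q_ge0; lra.
Qed.

Lemma regime_cases p q u : p <= 1 ->
  [|| heavy p u, good p q u, light q u, near q u | (p < 1) && near p u].
Proof.
rewrite le_eqVlt /heavy /good /light /near => /orP[/eqP->|p_le1].
  rewrite ltxx eqxx andbT/=.
  by case: (ltP (q * V)) => //= _; case: (leP u (q / _)).
rewrite p_le1 (lt_eqF p_le1)/=; case: (ltP (p * V)) => //= _.
case: (leP u (p / _)) => _/=; last by rewrite !orbT.
by rewrite andbT orbF; case: (ltP (q * V)) => //= _; case: (leP u (q / _)).
Qed.

End WeightRegimes.

Section LevelError.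
Variables (R : realFieldType) (n k : nat) (U : 'M[R]_(n, k)).
Variables (D1 D2 B : finType) (kept : pred D1) (bucket : D2 -> B) (V : R).
Local Notation coin := (D1 * D2 * bool)%type.
Local Notation Omega := {ffun 'I_n -> coin}.
Local Notation p := (keep_prob R kept).
Local Notation N := (#|B|%:R : R).
Local Notation q := (p / N).
Local Notation scale := (keep_scale R kept).
Local Notation lnorm := (level_norm kept bucket).
Local Notation Ux x := (fun i : 'I_n => (U *m x) i ord0).

Hypotheses (U_short : short_columns U) (p_gt0 : 0 < p) (D2_gt0 : (0 < #|D2|)%N).
Hypothesis bucket_unif : forall b, avg (fun a => (bucket a == b)%:R) <= N^-1.

Let coin_gt0 : (0 < #|{: coin}|)%N.
Proof.
by rewrite !card_prod card_bool !muln_gt0 (keep_space_gt0 p_gt0) D2_gt0.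
Qed.

Lemma bucket_space_gt0 : (0 < #|B|)%N.
Proof.
by have /card_gt0P[a _] := D2_gt0; apply/card_gt0P; exists (bucket a).
Qed.

Let N_gt0 : 0 < N. Proof. by rewrite ltr0n bucket_space_gt0. Qed.

Let q_gt0 : 0 < q. Proof. exact: divr_gt0. Qed.

Lemma avg_heavy_kept_le (P : pred 'I_n) : 0 < V ->
  (forall i, P i -> p * V <= weight U i) ->
  avg (fun w : Omega => (heavy_kept kept P w)%:R) <= k%:R / V.
Proof.
move=> V_gt0 PV.
apply: le_trans
  (avg_exists_le R (fun i (w : Omega) => P i && kept (w i).1.1)) _.
rewrite ler_pdivlMr//; apply: le_trans (sum_weight_le U_short).
rewrite mulr_suml; apply: ler_sum => i _; under eq_avg do rewrite -mulnb natrM.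
rewrite avgZl (avg_coord coin_gt0 i (fun d => (kept d.1.1)%:R)).
rewrite avg_kept//.
by case: (boolP (P i)) => Pi; rewrite ?mul1r ?mul0r ?PV ?weight_ge0.
Qed.

(* Light rows spread over all the buckets, where their random signs cancel. *)
Lemma avg_sup_light_le (P : pred 'I_n) : 0 < V ->
  (forall i, P i -> weight U i <= q / V ^+ 2) ->
  avg_sup_le (@box R k) (fun (w : Omega) x => lnorm w (mask P (Ux x)))
    (k%:R / V).
Proof.
move=> V_gt0 Pq.
pose z b i d := (P i)%:R * level_entry R kept bucket b d.
apply: eq_avg_sup_le (avg_sup_linear_le (z := z)
  U_short coin_gt0 V_gt0 bucket_space_gt0 _ _) => [w x|b i|i].
- apply: eq_bigr => b _.
  by congr (`|_|); apply: eq_bigr => i _; rewrite /z mulrCA mulrA.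
- by rewrite avgZl avg_level_entry mulr0.
- under eq_bigr => b _ do under eq_avg do rewrite exprMn.
  under eq_bigr do rewrite avgZl.
  rewrite -mulr_sumr sum_avg_sqr_level_entry// -natrX mulrCA.
  case: (boolP (P i)) => Pi; last by rewrite mul0r mul0r -exprVn sqr_ge0.
  have -> : V ^- 2 = N / p * (q / V ^+ 2) by field; rewrite !gt_eqF.
  by rewrite mul1r ler_wpM2l ?Pq// ltW// divr_gt0.
Qed.

Lemma avg_common_hits_le i j : i != j ->
  avg (fun w : Omega => common_hits R kept bucket w i j) <= p * q.
Proof.
move=> ij; pose h b (d : coin) : R := (hits kept bucket b d)%:R.
rewrite avg_sum (eq_bigr (fun b => avg (h b) * avg (h b))); last first.
  by move=> b _; exact: (avg_coord2 coin_gt0).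
apply: le_trans (_ : \sum_b avg (h b) * q <= _).
  apply: ler_sum => b _; rewrite ler_wpM2l ?avg_ge0// avg_hits//.
  by rewrite ler_wpM2l ?(ltW p_gt0).
rewrite -mulr_suml ler_wpM2r ?(ltW q_gt0)// -avg_sum.
by under eq_avg do rewrite sum_hits; rewrite avg_kept.
Qed.

(* Few rows satisfy [P], hence few of them collide. *)
Lemma avg_collision_mass_le (P : pred 'I_n) : 0 < V ->
  (forall i, P i -> q * V <= weight U i) ->
  avg (fun w : Omega => \sum_i \sum_(j | j != i)
    weight U i / p * ((P j)%:R * common_hits R kept bucket w i j))
  <= k%:R ^+ 2 / V.
Proof.
move=> V_gt0 PV.
apply: le_trans (_ : \sum_i \sum_j weight U i * ((P j)%:R * q) <= _).
  rewrite avg_sum; apply: ler_sum => i _.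
  rewrite [leRHS](bigID (fun j => j != i))/=.
  rewrite ler_wpDr ?sumr_ge0// => [j _|].
    by rewrite mulr_ge0 ?weight_ge0// mulr_ge0// (ltW q_gt0).
  under eq_avg do rewrite big_mkcond.
  rewrite avg_sum [leRHS]big_mkcond; apply: ler_sum => j _.
  case: ifP => [ji|_]; last by rewrite avg_cst ?card_ffun_gt0.
  rewrite !avgZl -mulrA ler_wpM2l ?weight_ge0// mulrCA ler_wpM2l//.
  by rewrite mulrC ler_pdivrMr// mulrC avg_common_hits_le// eq_sym.
under eq_bigr do rewrite -mulr_sumr.
rewrite -mulr_suml -mulr_suml expr2 -mulrA ler_pM ?sum_weight_le//.
- by rewrite sumr_ge0// => i _; exact: weight_ge0.
- by rewrite mulr_ge0 ?sumr_ge0// (ltW q_gt0).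
rewrite ler_pdivlMr// -mulrA mulr_suml.
apply: le_trans (sum_weight_le U_short).
apply: ler_sum => i _; case: (boolP (P i)) => Pi; rewrite ?mul1r ?mul0r ?PV//.
exact: weight_ge0.
Qed.

Lemma avg_sup_collisions_le (P : pred 'I_n) : 0 < V ->
  (forall i, P i -> q * V <= weight U i) ->
  avg_sup_le (@box R k) (fun (w : Omega) x =>
    `|lnorm w (mask P (Ux x))
      - \sum_i scale (w i) * ((P i)%:R * `|(U *m x) i ord0|)|) (k%:R ^+ 2 / V).
Proof.
move=> V_gt0 PV x x_box.
apply: le_trans (avg_collision_mass_le V_gt0 PV); apply: ler_avg => w.
apply: le_trans (level_norm_collisions _ p_gt0 _ _ _) _.
apply: ler_sum => i _; apply: ler_sum => j _; rewrite ler_wpM2r//.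
  by rewrite mulr_ge0// sumr_ge0// => b _; rewrite mulr_ge0.
rewrite ler_wpM2r ?invr_ge0 ?(ltW p_gt0)//.
by case: (P i); rewrite ?mul1r ?mul0r ?weight_ge0 ?norm_mulmx_le_weight.
Qed.

Lemma avg_sup_sampling_le (P : pred 'I_n) : 0 < V ->
  (forall i, P i -> (p^-1 - 1) * weight U i <= V ^- 2) ->
  avg_sup_le (@box R k) (fun (w : Omega) x =>
    `|\sum_i (P i)%:R * (scale (w i) - 1) * `|(U *m x) i ord0| |)
  (4 * k%:R / V).
Proof.
move=> V_gt0 PV.
apply: (avg_sup_norm_sum_norm_le U_short coin_gt0 V_gt0
  (z := fun i d => (P i)%:R * (scale d - 1))) => i.
  by rewrite avgZl avgB avg_keep_scale// avg_cst// subrr mulr0.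
under eq_avg do rewrite exprMn.
rewrite avgZl avg_sqr_keep_scale// -natrX.
by case: (boolP (P i)) => Pi; rewrite ?mul0r ?mul1r ?PV// -exprVn sqr_ge0.
Qed.

Lemma avg_sum_scale_weight (P : pred 'I_n) :
  avg (fun w : Omega => \sum_i (P i)%:R * (scale (w i) * weight U i))
  = \sum_i (P i)%:R * weight U i.
Proof.
rewrite avg_sum; apply: eq_bigr => i _.
by rewrite avgZl avgZr (avg_coord coin_gt0 i scale) avg_keep_scale// mul1r.
Qed.

Hypothesis V_gt1 : 1 < V.
Local Notation heavy_row := (fun i => heavy V p (weight U i)).
Local Notation good_row := (fun i => good V p q (weight U i)).
Local Notation light_row := (fun i => light V q (weight U i)).
Local Notation near_row := (fun i =>
  near V q (weight U i) || (p < 1) && near V p (weight U i)).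

Lemma avg_sup_level_norm_error : p <= 1 ->
  avg_sup_le (@box R k) (fun (w : Omega) x =>
    (~~ heavy_kept kept heavy_row w)%:R *
    `|lnorm w (Ux x) - \sum_i (good_row i)%:R * `|(U *m x) i ord0| |)
  (\sum_i (near_row i)%:R * weight U i + (5 * k%:R + k%:R ^+ 2) / V).
Proof.
move=> p_le1; have V_gt0 : 0 < V by exact: lt_trans V_gt1.
have -> : (5 * k%:R + k%:R ^+ 2) / V
  = k%:R / V + k%:R ^+ 2 / V + 4 * k%:R / V by ring.
have light_le := avg_sup_light_le (P := light_row) V_gt0 (fun i => id).
have /(avg_sup_collisions_le V_gt0) collisions_le i :
    good_row i -> q * V <= weight U i.
  by move=> /andP[/ltW].
have /(avg_sup_sampling_le V_gt0) sampling_le i :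
    good_row i -> (p^-1 - 1) * weight U i <= V ^- 2.
  move=> /andP[_ /orP[/eqP->|u_le]].
    by rewrite invr1 subrr mul0r -exprVn sqr_ge0.
  apply: le_trans (_ : p^-1 * weight U i <= _).
    by rewrite ler_wpM2r ?weight_ge0// gerBl.
  by rewrite mulrC ler_pdivrMr// mulrC.
rewrite -avg_sum_scale_weight !addrA.
apply: avg_sup_leW (avg_sup_leD (avg_sup_leD (avg_sup_leD
  (@avg_sup_le_cst _ _ _ _ _) light_le) collisions_le) sampling_le).
move=> w x x_box; case: (boolP (heavy_kept _ _ w)) => [_|].
  rewrite mul0r !addr_ge0// ?level_norm_ge0// sumr_ge0// => i _.
  by rewrite mulr_ge0// mulr_ge0 ?keep_scale_ge0 ?weight_ge0.
rewrite negb_exists mul1r => /forallP not_heavy.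
have disjoint i : ~~ (good_row i && light_row i).
  exact: good_light_disjoint (ltW q_gt0).
apply: le_trans (level_norm_split bucket p_gt0 w _ disjoint) _.
rewrite !lerD2r; apply: ler_sum => i _.
have [kept_i|/negPf notkept] := boolP (kept (w i).1.1); last first.
  by rewrite /keep_scale notkept !mul0r !mulr0.
apply: ler_pM => //; first by rewrite mulr_ge0 ?keep_scale_ge0.
  rewrite ler_nat; have := regime_cases V q (weight U i) p_le1.
  have := not_heavy i; rewrite kept_i andbT => /negPf->/=.
  by case: (good _ _ _ _) => //=; case: (light _ _ _) => //= ->.
by rewrite ler_wpM2l ?keep_scale_ge0 ?norm_mulmx_le_weight.
Qed.

End LevelError.

(** * Geometric scales with a random shift *)

Lemma sum_ord_mul (R : nmodType) (c q : nat) (F : nat -> R) :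
  \sum_(a < c * q) F a = \sum_(i < c) \sum_(j < q) F (i * q + j)%N.
Proof.
rewrite -(big_mkord xpredT) big_nat_mul big_mkord; apply: eq_bigr => i _.
rewrite -[X in \sum_(X <= _ < _) _]add0n big_addn mulSn addnK big_mkord.
by apply: eq_bigr => j _; rewrite addnC.
Qed.

Lemma avg_modn (R : realFieldType) (m q b : nat) :
  (0 < m)%N -> (q %| m)%N -> (b < q)%N ->
  avg (fun a : 'I_m => (a %% q == b)%N%:R) = q%:R^-1 :> R.
Proof.
move=> m_gt0 /dvdnP[c mE] bq; rewrite /avg card_ord; subst m.
rewrite (sum_ord_mul c q (fun a => (a %% q == b)%N%:R)).
rewrite (eq_bigr (fun=> 1)) => [|i _].
  rewrite sumr_const card_ord natrM invfM mulrA mulfV ?mul1r// pnatr_eq0.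
  by move: m_gt0; rewrite muln_gt0 lt0n => /andP[].
rewrite (bigD1 (Ordinal bq))//= modnMDl modn_small// eqxx big1 ?addr0// => j.
by rewrite -val_eqE modnMDl modn_small// => /negPf->.
Qed.

Section DecreasingScales.
Variables (R : realFieldType) (V : R) (scale : nat -> R) (u : R).
Hypotheses (scale0 : scale 0 = 1) (scaleS_lt1 : forall h, scale h.+1 < 1).

Let above h := scale h * V < u.

Let good_at h := good V (scale h) (scale h.+1) u.

Lemma goodS h : good_at h.+1 = above h.+2 && (u <= scale h.+1 / V ^+ 2).
Proof. by rewrite /good_at /good (lt_eqF (scaleS_lt1 h)). Qed.

Lemma above_le_sum_good m :
  (above m.+1 <= \sum_(h < m.+1) good_at h
    + \sum_(h < m) near V (scale h.+1) u)%N.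
Proof.
elim: m => [|m IH].
  by rewrite big_ord1 big_ord0 addn0 /good_at /good scale0 eqxx orTb andbT.
rewrite big_ord_recr [X in (_ <= _ + X)%N]big_ord_recr/= addnACA.
case: (boolP (above m.+1)) IH => [_ IH|not_above _].
  by apply: leq_trans (leq_b1 _) _; rewrite (leq_trans IH) ?leq_addr.
apply: leq_trans (leq_addl _ _); rewrite goodS /near.
move: not_above; rewrite /above -leNgt => ->; rewrite andbT.
by case: (_ < u) => //; case: ltP.
Qed.

Lemma sum_good_ge m : (1 <= \sum_(h < m.+1) good_at h + light V (scale m.+1) u
  + \sum_(h < m.+1) near V (scale h.+1) u)%N.
Proof.
have := above_le_sum_good m.
rewrite [X in (_ <= _ + _ + X)%N]big_ord_recr/= /light /near /above.
by case: (ltP (scale m.+1 * V)) => _;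
  case: (leP u (scale m.+1 / _)) => _ /=; lia.
Qed.

Hypotheses (V_gt1 : 1 < V) (scale_ge0 : forall h, 0 <= scale h).
Hypothesis scaleS_le : forall h, scale h.+1 <= scale h.

Lemma sum_good_le_above m : (\sum_(h < m.+1) good_at h <= above m.+1)%N.
Proof.
elim: m => [|m IH].
  by rewrite big_ord1 /good_at /good scale0 eqxx orTb andbT.
rewrite big_ord_recr/=; apply: leq_trans (leq_add IH (leqnn _)) _.
rewrite goodS /above; case: (ltP (scale m.+1 * V)) => above_m.
  rewrite (_ : (u <= _) = false) ?andbF ?addn0; last first.
    apply/negbTE; rewrite -ltNge.
    by rewrite (le_lt_trans (divV2_le V_gt1 (scale_ge0 _))).
  rewrite lt0b (le_lt_trans _ above_m)// ler_wpM2r ?scaleS_le//.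
  by rewrite (le_trans ler01)// ltW.
by case: (_ < _) => //=; exact: leq_b1.
Qed.

Lemma sum_good_le1 m : (\sum_(h < m.+1) good_at h <= 1)%N.
Proof. exact: leq_trans (sum_good_le_above m) (leq_b1 _). Qed.

End DecreasingScales.

Lemma sum_near_exprV_le (R : realFieldType) (V u : R) m : 1 < V ->
  (\sum_(e < m) near V (V ^- e) u <= 3)%N.
Proof.
move=> V_gt1; have V_gt0 : 0 < V by exact: lt_trans V_gt1.
pose above e := V ^- e * V < u.
have aboveS e : above e -> above e.+1.
  apply: le_lt_trans; rewrite ler_wpM2r ?(ltW V_gt0)//.
  rewrite lef_pV2 ?posrE ?exprn_gt0//.
  by rewrite exprS ler_peMl ?exprn_ge0 ?ltW.
have nearE e : (near V (V ^- e) u + above e)%N = above e.+3.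
  rewrite /near [above e.+3](_ : _ = (V ^- e / V ^+ 2 < u)); last first.
    by congr (_ < _); rewrite !exprS; field; rewrite expf_neq0 gt_eqF.
  have : above e -> V ^- e / V ^+ 2 < u.
    by apply: le_lt_trans; apply: divV2_le; rewrite ?invr_ge0 ?exprn_ge0 ?ltW.
  rewrite /above.
  by case: (ltP (_ * V)) => _; [move=> -> | rewrite andbT addn0].
suff : (\sum_(e < m) near V (V ^- e) u
    <= above m + above m.+1 + above m.+2)%N by lia.
elim: m => [|m IH]; first by rewrite big_ord0.
rewrite big_ord_recr/= -nearE; move: IH.
by set sum_near := (\sum_(e < m) _)%N; lia.
Qed.

(* Truncated subtraction: [cut K s 0 = 0], while [s] shifts all other cuts. *)
Definition cut (K s h : nat) := (h * K - s)%N.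

Lemma cutS_ge K s h : (cut K s h <= cut K s h.+1)%N.
Proof. by rewrite leq_sub2r// leq_mul2r leqnSn orbT. Qed.

Lemma cutS_sub_le K s h : (cut K s h.+1 - cut K s h <= K)%N.
Proof. by rewrite /cut mulSn; lia. Qed.

Lemma cutS_gt0 K s h : (s < K)%N -> (0 < cut K s h.+1)%N.
Proof. by rewrite /cut mulSn; lia. Qed.

Lemma avg_near_cut_le (R : realFieldType) (V u : R) K m : 1 < V ->
  avg (fun s : 'I_K => (\sum_(h < m) near V (V ^- cut K s h.+1) u)%N%:R)
  <= 3 / K%:R :> R.
Proof.
move=> V_gt1; rewrite /avg card_ord ler_wpM2r ?invr_ge0// -natr_sum ler_nat.
rewrite exchange_big/=.
rewrite (eq_bigr (fun h : 'I_m =>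
  \sum_(s < K) near V (V ^- (h * K + s).+1) u)%N).
  rewrite -(sum_ord_mul m K (fun e => near V (V ^- e.+1) u : nat)).
  apply: leq_trans (sum_near_exprV_le u (m * K).+1 V_gt1).
  by rewrite [leqRHS]big_ord_recl leq_addl.
move=> h _; rewrite (reindex_inj rev_ord_inj)/=; apply: eq_bigr => s _.
rewrite (_ : cut _ _ _ = (h * K + s).+1)//.
by rewrite /cut mulSn; have := ltn_ord s; lia.
Qed.

(** * The multi-level sketch *)

(* Padding with empty buckets gives all the levels equally many rows. *)
Lemma level_norm_comp_inj (R : realFieldType) (n : nat) (D1 D2 B B' : finType)
    (kept : pred D1) (bucket : D2 -> B) (f : B -> B')
    (w : {ffun 'I_n -> D1 * D2 * bool}) (v : 'I_n -> R) : injective f ->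
  level_norm kept (f \o bucket) w v = level_norm kept bucket w v.
Proof.
move=> f_inj; rewrite /level_norm (bigID (mem [set f b | b in [set: B]]%SET))/=.
rewrite [X in _ + X]big1 ?addr0 => [|b' notim].
  rewrite big_imset/= => [|b c _ _]; last exact: f_inj.
  apply: eq_big => [b|b _]; first by rewrite inE.
  congr (`|_|); apply: eq_bigr => i _; congr (_ * _).
  by rewrite /level_entry /hits/= (inj_eq f_inj).
rewrite big1 ?normr0// => i _; rewrite /level_entry /hits/=.
have /negPf -> : f (bucket (w i).1.2) != b'.
  by apply: contraNneq notim => <-; rewrite imset_f ?inE.
by rewrite andbF !mul0r.
Qed.

Section SketchLevels.
Variables (R : realFieldType) (W K H : nat).
Hypothesis W_gt1 : (1 < W)%N.
Local Notation V := (W%:R : R).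

(* All levels share these coins: only averages over single levels are added up,
   so the levels need not be independent. *)
Definition coin : finType := ('I_(W ^ (H * K)) * 'I_(W ^ K) * bool)%type.

Lemma expW_gt0 q : (0 < W ^ q)%N.
Proof. by rewrite expn_gt0 ltnW. Qed.

Definition level_kept e : pred 'I_(W ^ (H * K)) := fun a => (W ^ e %| a)%N.

Definition level_bucket q (a : 'I_(W ^ K)) : 'I_(W ^ q) :=
  Ordinal (ltn_pmod a (expW_gt0 q)).

Definition cut_gap s h := (cut K s h.+1 - cut K s h)%N.

Let V_gt1 : 1 < V. Proof. by rewrite ltr1n. Qed.

Let V_gt0 : 0 < V. Proof. exact: lt_trans V_gt1. Qed.

Let VX_gt0 e : 0 < V ^+ e. Proof. exact: exprn_gt0. Qed.

Lemma coin_gt0 : (0 < #|coin|)%N.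
Proof. by rewrite !card_prod !card_ord card_bool !muln_gt0 !expW_gt0. Qed.

Lemma keep_prob_level e : (e <= H * K)%N -> keep_prob R (level_kept e) = V ^- e.
Proof.
move=> eHK; rewrite /keep_prob -natrX.
rewrite -(@avg_modn R (W ^ (H * K)) _ 0) ?expW_gt0//.
by rewrite dvdn_exp2l.
Qed.

Lemma level_bucket_unif q : (q <= K)%N -> forall b,
  avg (fun a => (level_bucket q a == b)%:R) <= #|'I_(W ^ q)|%:R^-1 :> R.
Proof.
move=> qK b; rewrite card_ord -(@avg_modn R (W ^ K) _ b) ?expW_gt0//.
by rewrite dvdn_exp2l.
Qed.

Definition shifted_scale s h : R := V ^- cut K s h.

Lemma shifted_scale0 s : shifted_scale s 0 = 1.
Proof. by rewrite /shifted_scale /cut mul0n sub0n expr0 invr1. Qed.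

Lemma shifted_scaleS s h :
  shifted_scale s h.+1 = shifted_scale s h / V ^+ cut_gap s h.
Proof. by rewrite -invfM -exprD addnC subnK ?cutS_ge. Qed.

Lemma shifted_scale_le1 s h : shifted_scale s h <= 1.
Proof. by rewrite invf_le1 ?VX_gt0// exprn_ege1// ltW. Qed.

Lemma shifted_scaleS_lt1 s h : (s < K)%N -> shifted_scale s h.+1 < 1.
Proof.
by move=> sK; rewrite invf_lt1 ?VX_gt0// exprn_egt1// -lt0n cutS_gt0.
Qed.

Lemma shifted_scaleS_le s h : shifted_scale s h.+1 <= shifted_scale s h.
Proof. by rewrite lef_pV2 ?posrE ?VX_gt0// ler_eXn2l ?cutS_ge. Qed.

Section Error.
Variables (n k : nat) (U : 'M[R]_(n, k)).
Hypothesis U_short : short_columns U.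
Local Notation wt := (weight U).
Local Notation Omega := {ffun 'I_n -> coin}.
Local Notation Ux x := (fun i : 'I_n => (U *m x) i ord0).

Definition sketch_level s h : Omega -> ('I_n -> R) -> R :=
  level_norm (level_kept (cut K s h)) (@level_bucket (cut_gap s h)).

Definition level_lost s h : pred Omega :=
  heavy_kept (level_kept (cut K s h))
    (fun i => heavy V (shifted_scale s h) (wt i)).

Definition lost s (w : Omega) := [exists h : 'I_H.+1, level_lost s h w].

Definition good_at s h i :=
  good V (shifted_scale s h) (shifted_scale s h.+1) (wt i).

Definition near_count s i :=
  (\sum_(h < H.+1) near V (shifted_scale s h.+1) (wt i))%N.

Let cut_le s h : (h <= H)%N -> (cut K s h <= H * K)%N.
Proof.
by move=> hH; rewrite leq_subLR (leq_trans (leq_mul hH (leqnn K))) ?leq_addl.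
Qed.

Lemma avg_level_lost_le s h : (h <= H)%N ->
  avg (fun w => (level_lost s h w)%:R) <= k%:R / V.
Proof.
move=> hH; have pE := keep_prob_level (cut_le s hH).
apply: avg_heavy_kept_le => //; first by rewrite pE invr_gt0 VX_gt0.
- by rewrite card_ord expW_gt0.
- by move=> i /andP[_ /ltW]; rewrite pE.
Qed.

Definition level_error s h (w : Omega) (x : 'cV[R]_k) : R :=
  (~~ level_lost s h w)%:R * `|sketch_level s h w (Ux x)
    - \sum_i (good_at s h i)%:R * `|(U *m x) i ord0| |.

Definition uncounted_mass s : R :=
  \sum_i (light V (shifted_scale s H.+1) (wt i) + near_count s i)%N%:R * wt i.

Definition sketch_error s (w : Omega) (x : 'cV[R]_k) : R :=
  `|\sum_(h < H.+1) sketch_level s h w (Ux x) - \sum_i `|(U *m x) i ord0| |.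

Lemma avg_sup_level_error s h : (s < K)%N -> (h <= H)%N ->
  avg_sup_le (@box R k) (level_error s h)
  (\sum_i (near V (shifted_scale s h.+1) (wt i)
           + ((0 < h) && near V (shifted_scale s h) (wt i)))%N%:R * wt i
   + (5 * k%:R + k%:R ^+ 2) / V).
Proof.
move=> sK hH; have pE := keep_prob_level (cut_le s hH).
have p_gt0 : 0 < keep_prob R (level_kept (cut K s h)).
  by rewrite pE invr_gt0 VX_gt0.
have hash_gt0 : (0 < #|'I_(W ^ K)|)%N by rewrite card_ord expW_gt0.
have := avg_sup_level_norm_error U_short p_gt0 hash_gt0
  (level_bucket_unif (cutS_sub_le K s h)) V_gt1.
rewrite pE card_ord natrX -/(shifted_scale s h) -shifted_scaleS.
move=> /(_ (shifted_scale_le1 s h)) level_le x x_box.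
apply: le_trans (level_le x x_box) _.
rewrite lerD2r; apply: ler_sum => i _; rewrite ler_wpM2r ?weight_ge0// ler_nat.
case: h {hH pE p_gt0 level_le} => [|h]; last first.
  by case: near; case: near; case: (_ < 1).
by rewrite shifted_scale0 ltxx orbF addn0.
Qed.

Lemma sum_near_le s i :
  (\sum_(h < H.+1) (near V (shifted_scale s h.+1) (wt i)
     + ((0 < h) && near V (shifted_scale s h) (wt i)))
   <= 2 * near_count s i)%N.
Proof.
rewrite big_split/= mul2n -addnn leq_add2l big_ord_recl/= add0n.
by rewrite [leqRHS]big_ord_recr/= leq_addr.
Qed.

Lemma good_mass_dist_le s x : (s < K)%N -> box x ->
  `|\sum_(h < H.+1) \sum_i (good_at s h i)%:R * `|(U *m x) i ord0|
    - \sum_i `|(U *m x) i ord0| |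
  <= uncounted_mass s.
Proof.
move=> sK x_box; rewrite exchange_big -sumrB.
apply: le_trans (ler_norm_sum _ _ _) _; apply: ler_sum => i _.
have scale_ge0 h : 0 <= shifted_scale s h by rewrite invr_ge0 ltW// VX_gt0.
have scaleS_lt1 h := shifted_scaleS_lt1 h sK.
have scaleS_le := shifted_scaleS_le s.
have good_le1 := sum_good_le1 (wt i)
  (shifted_scale0 s) scaleS_lt1 V_gt1 scale_ge0 scaleS_le H.
have good_ge := sum_good_ge V (wt i) (shifted_scale0 s) scaleS_lt1 H.
rewrite -mulr_suml -[X in `|_ - X|]mul1r -mulrBl normrM normr_id.
apply: ler_pM => //; last exact: norm_mulmx_le_weight.
rewrite -natr_sum distrC ger0_norm ?subr_ge0 ?lern1//.
by rewrite lerBlDl -natrD ler1n addnA.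
Qed.

Lemma sum_light_le s : (s < K)%N -> (n <= W ^ H)%N ->
  \sum_i (light V (shifted_scale s H.+1) (wt i))%:R * wt i <= V^-1.
Proof.
move=> sK nW; have scale_ge0 : 0 <= shifted_scale s H.+1 / V ^+ 2.
  by rewrite divr_ge0 ?invr_ge0 ?exprn_ge0.
apply: le_trans (_ : \sum_(i < n) shifted_scale s H.+1 / V ^+ 2 <= _).
  apply: ler_sum => i _; case: (boolP (light _ _ _)) => [|_].
    by rewrite mul1r.
  by rewrite mul0r.
rewrite sumr_const card_ord -[leLHS]mulr_natl.
apply: le_trans (_ : V ^+ H * (V ^- H / V ^+ 2) <= _).
  apply: ler_pM => //; first by rewrite -natrX ler_nat.
  rewrite ler_wpM2r ?invr_ge0 ?exprn_ge0//.
  by rewrite lef_pV2 ?posrE ?VX_gt0// ler_eXn2l// /cut mulSn; nia.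
rewrite mulrA mulfV ?gt_eqF ?VX_gt0// mul1r lef_pV2 ?posrE ?VX_gt0//.
by rewrite expr2 ler_peMl// ltW.
Qed.

Lemma uncounted_mass_le s : (s < K)%N -> (n <= W ^ H)%N ->
  uncounted_mass s <= V^-1 + \sum_i (near_count s i)%:R * wt i.
Proof.
move=> sK nW; rewrite /uncounted_mass; under eq_bigr do rewrite natrD mulrDl.
by rewrite big_split/= lerD2r sum_light_le.
Qed.

Lemma sketch_error_le s w x : (s < K)%N -> box x ->
  (~~ lost s w)%:R * sketch_error s w x
  <= \sum_(h < H.+1) level_error s h w x + uncounted_mass s.
Proof.
move=> sK x_box; case: (boolP (lost s w)) => [_|].
  rewrite mul0r addr_ge0 ?sumr_ge0// => [h _|i _]; first exact: mulr_ge0.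
  by rewrite mulr_ge0 ?weight_ge0.
rewrite negb_exists mul1r => /forallP not_lost.
pose good_mass h : R := \sum_i (good_at s h i)%:R * `|(U *m x) i ord0|.
rewrite (eq_bigr (fun h : 'I_H.+1 =>
  `|sketch_level s h w (Ux x) - good_mass h|)) => [|h _]; last first.
  by rewrite /level_error not_lost mul1r.
rewrite /sketch_error.
rewrite -(subrK (\sum_(h < H.+1) good_mass h) (\sum_h _)) -sumrB -addrA.
apply: le_trans (ler_normD _ _) (lerD _ (good_mass_dist_le sK x_box)).
exact: ler_norm_sum.
Qed.

Lemma avg_sup_sketch_error s : (s < K)%N -> (n <= W ^ H)%N ->
  avg_sup_le (@box R k) (fun w x => (~~ lost s w)%:R * sketch_error s w x)
  (3 * \sum_i (near_count s i)%:R * wt i + V^-1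
   + H.+1%:R * ((5 * k%:R + k%:R ^+ 2) / V)).
Proof.
move=> sK nW x x_box.
have levels_le := avg_sup_le_sum (fun h : 'I_H.+1 =>
  avg_sup_level_error sK (ltn_ord h : (h <= H)%N)) x_box.
apply: le_trans (ler_avg (fun w => sketch_error_le w sK (x_box w))) _.
rewrite avgD avg_cst ?card_ffun_gt0 ?coin_gt0//.
apply: le_trans (lerD levels_le (uncounted_mass_le sK nW)) _.
rewrite big_split/= sumr_const card_ord -[X in _ + X + _ <= _]mulr_natl.
rewrite exchange_big/=; set bulk := H.+1%:R * _.
have : \sum_i \sum_(h < H.+1) (near V (shifted_scale s h.+1) (wt i)
     + ((0 < h) && near V (shifted_scale s h) (wt i)))%N%:R * wt i
   <= 2 * \sum_i (near_count s i)%:R * wt i.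
  rewrite mulr_sumr; apply: ler_sum => i _.
  rewrite -mulr_suml -natr_sum mulrA ler_wpM2r ?weight_ge0//.
  by rewrite -natrM ler_nat sum_near_le.
lra.
Qed.

Lemma avg_lost_le : (0 < K)%N ->
  avg (fun t : 'I_K * Omega => (lost t.1 t.2)%:R) <= H.+1%:R * (k%:R / V).
Proof.
move=> K_gt0; rewrite mulr_natl -[X in _ *+ X]card_ord -sumr_const.
apply: le_trans (avg_exists_le _ _) _; apply: ler_sum => h _.
rewrite avg_pair/= -(@avg_cst R 'I_K _ (k%:R / V)) ?card_ord//.
by apply: ler_avg => s; apply: avg_level_lost_le; rewrite -ltnS.
Qed.

Lemma avg_sup_sketch_error_random_shift : (0 < K)%N -> (n <= W ^ H)%N ->
  avg_sup_le (@box R k) (fun (t : 'I_K * Omega) x =>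
    (~~ lost t.1 t.2)%:R * sketch_error t.1 t.2 x)
  (9 * k%:R / K%:R + V^-1 + H.+1%:R * ((5 * k%:R + k%:R ^+ 2) / V)).
Proof.
move=> K_gt0 nW.
have := avg_sup_le_pair (F := fun (t : 'I_K * Omega) x =>
    (~~ lost t.1 t.2)%:R * sketch_error t.1 t.2 x)
  (fun s => avg_sup_sketch_error (ltn_ord s) nW).
move=> error_le x x_box; apply: le_trans (error_le x x_box) _.
rewrite !avgD !avg_cst ?card_ord// !lerD2r avgZl avg_sum.
have -> : 9 * k%:R / K%:R = 3 * (3 / K%:R * k%:R) :> R.
  by field; rewrite pnatr_eq0 -lt0n.
rewrite ler_wpM2l//.
apply: le_trans (_ : 3 / K%:R * \sum_i wt i <= _); last first.
  by rewrite ler_wpM2l ?divr_ge0// sum_weight_le.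
rewrite mulr_sumr; apply: ler_sum => i _; rewrite avgZr ler_wpM2r ?weight_ge0//.
exact: avg_near_cut_le.
Qed.

Lemma avg_sketch_failure_le e : 0 < e -> (0 < K)%N -> (n <= W ^ H)%N ->
  avg (fun t : 'I_K * Omega =>
    (~~ `[< forall x, box x -> sketch_error t.1 t.2 x <= e >])%:R)
  <= H.+1%:R * (k%:R / V)
     + (9 * k%:R / K%:R + V^-1 + H.+1%:R * ((5 * k%:R + k%:R ^+ 2) / V)) / e.
Proof.
move=> e_gt0 K_gt0 nW.
have error_le := avg_sup_le_markov e_gt0 (ex_intro _ _ (@box0 R k)) _
  (avg_sup_sketch_error_random_shift K_gt0 nW).
apply: le_trans (lerD (avg_lost_le K_gt0) (error_le _)) => [|t x]; last first.
  by rewrite mulr_ge0 ?normr_ge0.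
rewrite -avgD; apply: ler_avg => t; case: (boolP (lost t.1 t.2)) => [_|_].
  by apply: le_trans (_ : 1 <= _); rewrite ?lern1 ?leq_b1// lerDl.
rewrite add0r; case: asboolP => //= nerr; case: asboolP => // err; case: nerr.
by move=> x x_box; have := err x x_box; rewrite mul1r.
Qed.

End Error.
End SketchLevels.

(** * The sketch matrix *)

Lemma l1normZ (R : realType) m (c : R) (v : 'cV[R]_m) :
  l1norm (c *: v) = `|c| * l1norm v.
Proof.
by rewrite /l1norm mulr_sumr; apply: eq_bigr => i _; rewrite mxE normrM.
Qed.

Lemma l1norm_ge0 (R : realType) m (v : 'cV[R]_m) : 0 <= l1norm v.
Proof. exact: sumr_ge0. Qed.

Lemma l1norm0 (R : realType) m : l1norm (0 : 'cV[R]_m) = 0.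
Proof. by rewrite /l1norm big1// => i _; rewrite mxE normr0. Qed.

Lemma l1norm_eq0 (R : realType) m (v : 'cV[R]_m) : l1norm v = 0 -> v = 0.
Proof.
move=> /eqP; rewrite psumr_eq0// => /allP v0; apply/colP => i; rewrite mxE.
by apply/eqP; rewrite -normr_eq0; exact: (v0 i (mem_index_enum i)).
Qed.

Section SketchMatrix.
Variables (R : realType) (W K H n : nat).
Hypothesis W_gt1 : (1 < W)%N.
Local Notation Omega := {ffun 'I_n -> coin W K H}.

Lemma card_level_buckets_le s h : (W ^ cut_gap K s h <= W ^ K)%N.
Proof. by rewrite leq_pexp2l ?cutS_sub_le ?(ltnW W_gt1). Qed.

Definition padded_bucket s h : 'I_(W ^ K) -> 'I_(W ^ K) :=
  widen_ord (card_level_buckets_le s h) \o level_bucket W_gt1 (cut_gap K s h).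

Definition sketch_entry s (h : 'I_H.+1) (b : 'I_(W ^ K)) : coin W K H -> R :=
  level_entry R (@level_kept W K H (cut K s h)) (padded_bucket s h) b.

Definition sketch_mx s (w : Omega) : 'M[R]_(H.+1 * W ^ K, n) :=
  \matrix_(r, i) mxvec (\matrix_(h, b) sketch_entry s h b (w i)) ord0 r.

Lemma sketch_mxE s w h b i :
  sketch_mx s w (mxvec_index h b) i = sketch_entry s h b (w i).
Proof. by rewrite mxE mxvecE mxE. Qed.

Lemma l1norm_sketch_mx s w (v : 'cV[R]_n) : l1norm (sketch_mx s w *m v)
  = \sum_(h < H.+1) sketch_level W_gt1 s h w (fun i => v i ord0).
Proof.
rewrite /l1norm (reindex _ (curry_mxvec_bij _ _))/=.
rewrite (eq_bigr (fun p => `|(sketch_mx s w *m v) (mxvec_index p.1 p.2) ord0|));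
  last by case.
rewrite -(pair_bigA _
  (fun h b => `|(sketch_mx s w *m v) (mxvec_index h b) ord0|))/=.
apply: eq_bigr => h _; rewrite /sketch_level.
have widen_inj : injective (widen_ord (card_level_buckets_le s h)).
  by move=> a b /(congr1 val) ab; exact: val_inj.
rewrite -(level_norm_comp_inj _ _ _ _ widen_inj).
apply: eq_bigr => b _; rewrite mxE; congr (`|_|).
by apply: eq_bigr => i _; rewrite sketch_mxE.
Qed.

Lemma col_sparse_sketch_mx s w : col_sparse H.+1%:R (sketch_mx s w).
Proof.
move=> i; rewrite ler_nat -[leqRHS]card_ord -cardsT.
pose row_of (h : 'I_H.+1) := mxvec_index h (padded_bucket s h (w i).1.2).
apply: leq_trans _ (leq_imset_card row_of _).
apply/subset_leq_card/fintype.subsetP => r.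
case/mxvec_indexP: r => h b.
rewrite inE sketch_mxE /sketch_entry /level_entry /hits.
have [<- _|] := eqVneq (padded_bucket s h (w i).1.2) b; first exact: imset_f.
by rewrite andbF !mul0r eqxx.
Qed.

End SketchMatrix.

(** * Near-Auerbach bases *)

Lemma det_replace_col (R : comNzRingType) k (j : 'I_k) (y : 'cV[R]_k) :
  \det (\matrix_(a, b) if b == j then y a ord0 else (a == b)%:R) = y j ord0.
Proof.
set N := \matrix_(a, b) _.
rewrite (expand_det_row N j) (bigD1 j)//= big1 => [|b /negPf bj]; last first.
  by rewrite mxE bj eq_sym bj mul0r.
rewrite addr0 mxE eqxx /cofactor -signr_odd addnn odd_double mul1r.
rewrite [row' _ _](_ : _ = 1%:M) ?det1 ?mulr1//; apply/matrixP => a b.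
by rewrite !mxE eq_sym (negPf (neq_lift _ _)) (inj_eq lift_inj).
Qed.

Section NearAuerbach.
Variables (R : realType) (k : nat) (nu : 'cV[R]_k -> R) (M theta : R).
Hypotheses (nu_ge0 : forall x, 0 <= nu x) (theta_gt1 : 1 < theta).
Hypothesis nuZ : forall a (x : 'cV[R]_k), nu (a *: x) = `|a| * nu x.
Hypothesis M_ge0 : 0 <= M.
Hypothesis coord_le : forall (x : 'cV[R]_k) i, `|x i ord0| <= M * nu x.

Definition unit_ball_columns (G : 'M[R]_k) := forall j, nu (col j G) <= 1.

Lemma has_ubound_det_unit_ball_columns :
  has_ubound [set \det G | G in unit_ball_columns]%classic.
Proof.
exists (\sum_(s : 'S_k) M ^+ k) => _ [G G_ball <-].
apply: le_trans (ler_norm _) _.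
apply: le_trans (ler_norm_sum _ _ _) _; apply: ler_sum => s _.
rewrite normrM normrX normrN1 expr1n mul1r normr_prod.
rewrite -[k in X in _ <= X]card_ord -prodr_const; apply: ler_prod => i _.
rewrite normr_ge0/=; have := coord_le (col (s i) G) i; rewrite mxE.
by move=> /le_trans; apply; rewrite ler_piMr.
Qed.

Lemma exists_unit_ball_columns_det_gt0 :
  exists2 G, unit_ball_columns G & 0 < \det G.
Proof.
pose e (j : 'I_k) : 'cV[R]_k := delta_mx j ord0.
pose c := (1 + \sum_j nu (e j))^-1.
have e_ge0 : 0 <= \sum_j nu (e j) by exact: sumr_ge0.
have c_gt0 : 0 < c by rewrite invr_gt0; lra.
exists c%:M; last by rewrite det_scalar exprn_gt0.
move=> j; have -> : col j c%:M = c *: e j.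
  by apply/colP => i; rewrite !mxE andbT mulr_natr.
rewrite nuZ gtr0_norm// /c mulrC ler_pdivrMr ?mul1r; last by lra.
apply: le_trans (_ : \sum_j nu (e j) <= _); last by lra.
by rewrite (bigD1 j)//= lerDl sumr_ge0.
Qed.

Lemma exists_near_max_det : exists2 G, unit_ball_columns G & 0 < \det G /\
  forall G', unit_ball_columns G' -> \det G' <= theta * \det G.
Proof.
set E := [set \det G | G in unit_ball_columns]%classic.
have [G0 G0_ball detG0] := exists_unit_ball_columns_det_gt0.
have detE G : unit_ball_columns G -> \det G <= sup E.
  move=> G_ball.
  by apply: (ub_le_sup has_ubound_det_unit_ball_columns); exists G.
have sup_gt0 : 0 < sup E by exact: lt_le_trans (detE _ G0_ball).
have theta_gt0 : 0 < theta by exact: lt_trans theta_gt1.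
have E_sup : has_sup E.
  by split; [exists (\det G0), G0 | exact: has_ubound_det_unit_ball_columns].
have gap_gt0 : 0 < sup E - sup E / theta.
  by rewrite subr_gt0 ltr_pdivrMr// ltr_pMr.
have [_ [G G_ball <-]] := sup_adherent gap_gt0 E_sup; rewrite subKr => detG.
exists G => //; split=> [|G' /detE].
  by apply: lt_trans detG; exact: divr_gt0.
by move=> /le_trans; apply; rewrite ltW// mulrC -ltr_pdivrMr.
Qed.

(* A basis of nearly maximal determinant; no compactness argument is needed. *)
Lemma near_auerbach_basis : exists2 G : 'M[R]_k, G \in unitmx &
  unit_ball_columns G /\
  forall (x : 'cV[R]_k) j, `|x j ord0| <= theta * nu (G *m x).
Proof.
have [G G_ball [detG G_max]] := exists_near_max_det.
have Gu : G \in unitmx by rewrite unitmxE unitfE gt_eqF.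
exists G => //; split=> //.
have coord_le_theta (y : 'cV[R]_k) j : nu (G *m y) <= 1 -> y j ord0 <= theta.
  move=> y_ball; pose N : 'M[R]_k :=
    \matrix_(a, b) if b == j then y a ord0 else (a == b)%:R.
  have colN l : col l N = if l == j then y else delta_mx l ord0.
    by apply/colP => a; rewrite !mxE; case: ifP => // _; rewrite mxE eqxx andbT.
  have /G_max : unit_ball_columns (G *m N).
    move=> l; rewrite colE -mulmxA -colE colN.
    by case: ifP => // _; rewrite -colE.
  by rewrite det_mulmx det_replace_col mulrC ler_pM2r.
have coord_le_nu (y : 'cV[R]_k) j : y j ord0 <= theta * nu (G *m y).
  have [nu0|nu_neq0] := eqVneq (nu (G *m y)) 0.
    rewrite nu0 mulr0; suff -> : y = 0 by rewrite mxE.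
    rewrite -[y](mulKmx Gu) (_ : G *m y = 0) ?mulmx0//; apply/colP => i.
    rewrite [RHS]mxE; apply/eqP; rewrite -normr_eq0 eq_le normr_ge0 andbT.
    by rewrite (le_trans (coord_le _ _)) ?nu0 ?mulr0.
  have nu_gt0 : 0 < nu (G *m y) by rewrite lt_def nu_neq0 nu_ge0.
  rewrite -ler_pdivrMr// mulrC.
  have := coord_le_theta ((nu (G *m y))^-1 *: y) j.
  by rewrite mxE; apply; rewrite -scalemxAr nuZ gtr0_norm ?invr_gt0// mulVf.
move=> x j; rewrite ler_norml coord_le_nu andbT lerNl.
have := coord_le_nu (- x) j.
by rewrite mulmxN -(scaleN1r (G *m x)) nuZ normrN1 mul1r mxE.
Qed.

End NearAuerbach.

Lemma l1_well_conditioned_basis (R : realType) n d (A : 'M[R]_(n, d)) :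
  exists k (U : 'M[R]_(n, k)) (C : 'M[R]_(k, d)),
    [/\ (k <= d)%N, A = U *m C, short_columns U &
        forall (x : 'cV[R]_k) j, `|x j ord0| <= 2 * l1norm (U *m x)].
Proof.
have /row_fullP[L LB] := col_base_full A; set B := col_base A in LB.
pose M := \sum_i \sum_l `|L i l|.
have M_ge0 : 0 <= M by apply: sumr_ge0 => i _; exact: sumr_ge0.
have coord_le (x : 'cV[R]_(\rank A)) i : `|x i ord0| <= M * l1norm (B *m x).
  rewrite -{1}[x]mul1mx -LB -mulmxA mxE mulr_sumr.
  apply: le_trans (ler_norm_sum _ _ _) _; apply: ler_sum => l _.
  rewrite normrM ler_wpM2r// /M (bigD1 i)//= (bigD1 l)//= -addrA lerDl.
  by rewrite addr_ge0 ?sumr_ge0// => a _; exact: sumr_ge0.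
have normZ a (x : 'cV[R]_(\rank A)) :
    l1norm (B *m (a *: x)) = `|a| * l1norm (B *m x).
  by rewrite -scalemxAr l1normZ.
have [G Gu [G_ball G_coord]] := near_auerbach_basis
  (nu := fun x => l1norm (B *m x)) (fun x => l1norm_ge0 _) (ltr1n R 2)
  normZ M_ge0 coord_le.
exists (\rank A), (B *m G), (invmx G *m row_base A); split.
- exact: rank_leq_col.
- by rewrite mulmxA mulmxK// mulmx_base.
- move=> j; have := G_ball j; rewrite colE mulmxA -colE /l1norm.
  by under eq_bigr do rewrite mxE.
- by move=> x j; rewrite -mulmxA.
Qed.

(** * From the box to all vectors *)

Lemma l1_embedsMr (R : realType) r n k d (U : 'M[R]_(n, k)) (C : 'M[R]_(k, d))
    (S : 'M[R]_(r, n)) eps : l1_embeds eps U S -> l1_embeds eps (U *m C) S.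
Proof. by move=> US x; have := US (C *m x); rewrite !mulmxA. Qed.

Lemma l1_embeds_no_column (R : realType) r n (A : 'M[R]_(n, 0))
    (S : 'M[R]_(r, n)) eps :
  l1_embeds eps A S.
Proof.
by move=> x; rewrite [A]thinmx0 mulmx0 !mul0mx !l1norm0 !mulr0.
Qed.

Lemma box_l1_embeds (R : realType) r n k (U : 'M[R]_(n, k))
    (S : 'M[R]_(r, n)) c eps :
  0 < c -> (forall (x : 'cV[R]_k) j, `|x j ord0| <= c * l1norm (U *m x)) ->
  (forall x, box x -> `|l1norm (S *m (U *m x)) - l1norm (U *m x)| <= eps / c) ->
  l1_embeds eps U S.
Proof.
move=> c_gt0 Ux SU x; rewrite -mulmxA.
have [m_eq0|m_neq0] := eqVneq (l1norm (U *m x)) 0.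
  by rewrite (l1norm_eq0 m_eq0) mulmx0 !l1norm0 !mulr0.
have m_gt0 : 0 < l1norm (U *m x) by rewrite lt_def m_neq0 l1norm_ge0.
set m := l1norm (U *m x) in m_gt0 *.
have cm_gt0 : 0 < (c * m)^-1 by rewrite invr_gt0 mulr_gt0.
have /SU : box ((c * m)^-1 *: x).
  move=> j; rewrite mxE normrM gtr0_norm// mulrC ler_pdivrMr ?mulr_gt0// mul1r.
  exact: Ux.
rewrite -!scalemxAr !l1normZ (gtr0_norm cm_gt0) -mulrBr normrM.
rewrite (gtr0_norm cm_gt0).
rewrite -/m mulrC ler_pdivrMr ?mulr_gt0// mulrA divfK ?gt_eqF// ler_norml.
by move=> /andP[lo hi]; split; lra.
Qed.

Lemma level_terms_le (R : realFieldType) (k d h : nat) (V : R) :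
  (k <= d)%N -> (0 < d)%N -> (0 < h)%N -> 0 < V ->
  [/\ h%:R * (k%:R / V) <= d%:R ^+ 2 * h%:R / V, V^-1 <= d%:R ^+ 2 * h%:R / V &
      h%:R * ((5 * k%:R + k%:R ^+ 2) / V) <= 6 * (d%:R ^+ 2 * h%:R / V)].
Proof.
move=> kd d_gt0 h_gt0 V_gt0.
have k_le_d : k%:R <= d%:R :> R by rewrite ler_nat.
have d_ge1 : 1 <= d%:R :> R by rewrite ler1n.
have h_ge1 : 1 <= h%:R :> R by rewrite ler1n.
have k_ge0 : 0 <= k%:R :> R by [].
have dominated c e : c <= e * d%:R ^+ 2 ->
    h%:R * (c / V) <= e * (d%:R ^+ 2 * h%:R / V).
  move=> ce; rewrite mulrCA.
  have -> : e * (d%:R ^+ 2 * h%:R / V) = e * d%:R ^+ 2 * (h%:R / V) by ring.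
  by rewrite ler_wpM2r// divr_ge0 ?(ltW V_gt0).
split.
- by rewrite -[leRHS]mul1r dominated//; nra.
- by rewrite -[leLHS]mul1r ler_wpM2r ?invr_ge0 ?(ltW V_gt0)//; nra.
- by apply: dominated; nra.
Qed.

Lemma failure_bound_le (R : realFieldType) (k d h : nat) (V N eps delta : R) :
  (k <= d)%N -> (0 < d)%N -> (0 < h)%N -> 0 < V -> 0 < N ->
  0 < eps < 1 -> 0 < delta ->
  30 * d%:R ^+ 2 * h%:R / (eps * delta) <= V ->
  36 * d%:R / (eps * delta) <= N ->
  h%:R * (k%:R / V)
    + (9 * k%:R / N + V^-1 + h%:R * ((5 * k%:R + k%:R ^+ 2) / V)) / (eps / 2)
  <= delta.
Proof.
move=> kd d_gt0 h_gt0 V_gt0 N_gt0 /andP[eps_gt0 eps_lt1] delta_gt0 V_ge N_ge.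
have epsdelta_gt0 : 0 < eps * delta by rewrite mulr_gt0.
have [] := level_terms_le kd d_gt0 h_gt0 V_gt0.
set q := d%:R ^+ 2 * h%:R / V => lost_le V_le levels_le.
have q_le : 30 * q <= eps * delta.
  by rewrite /q 2!(mulrA 30) ler_pdivrMr// [leRHS]mulrC -ler_pdivrMr.
have shift_le : 9 * k%:R / N <= eps * delta / 4.
  have : 36 * d%:R / N <= eps * delta.
    by rewrite ler_pdivrMr// [leRHS]mulrC -ler_pdivrMr.
  have : 9 * k%:R / N <= 9 * d%:R / N.
    by rewrite ler_wpM2r ?invr_ge0 ?(ltW N_gt0)// ler_wpM2l// ler_nat.
  lra.
have error_le : (9 * k%:R / N + V^-1 + h%:R * ((5 * k%:R + k%:R ^+ 2) / V))
    / (eps / 2) <= delta * (29 / 30).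
  by rewrite ler_pdivrMr ?divr_gt0//; lra.
have : eps * delta <= delta by rewrite ler_piMl ?ltW.
lra.
Qed.

Lemma avg_sketch_mx_failure_le (R : realType) (W K H n d : nat)
    (W_gt1 : (1 < W)%N) (A : 'M[R]_(n, d)) (eps delta : R) :
  (0 < K)%N -> (n <= W ^ H)%N -> (0 < d)%N -> 0 < eps < 1 -> 0 < delta ->
  30 * d%:R ^+ 2 * H.+1%:R / (eps * delta) <= W%:R ->
  36 * d%:R / (eps * delta) <= K%:R ->
  avg (fun t : 'I_K * {ffun 'I_n -> coin W K H} =>
    (~~ `[< l1_embeds eps A (sketch_mx R W_gt1 t.1 t.2) >])%:R : R) <= delta.
Proof.
move=> K_gt0 nW d_gt0 eps01 delta_gt0 W_ge K_ge; have [eps_gt0 _] := andP eps01.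
have [k [U [C [kd -> U_short Ux]]]] := l1_well_conditioned_basis A.
apply: le_trans (failure_bound_le kd d_gt0 _ _ _ eps01 delta_gt0 W_ge K_ge);
  rewrite ?ltr0n ?(ltnW W_gt1)//.
apply: le_trans (avg_sketch_failure_le W_gt1 U_short _ K_gt0 nW); last first.
  by rewrite divr_gt0.
apply: ler_avg => t; rewrite ler_nat.
case: (asboolP (l1_embeds _ _ _)) => // not_embeds.
case: asboolP => // box_le; case: not_embeds; apply: l1_embedsMr.
apply: box_l1_embeds (ltr0n R 2) Ux _ => x x_box.
by rewrite l1norm_sketch_mx; exact: box_le.
Qed.

(** * Uniform distributions on matrices *)

Section UniformOn.
Context (R : realType) (disp : measure_display) (X : measurableType disp).
Variables (T : finType) (t0 : T) (S : T -> X).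

Lemma inv_card_ge0 : 0 <= (#|T|%:R^-1 : R).
Proof. by rewrite invr_ge0. Qed.

(* The law of [S t] for [t] uniform in [T]. *)
Definition uniform_on : set X -> \bar R :=
  mscale (NngNum inv_card_ge0)
    (msum (fun i => \d_(S (nth t0 (enum T) i))) #|T|).

HB.instance Definition _ := Measure.on uniform_on.

Lemma uniform_onE E : uniform_on E = (avg (fun t => (S t \in E)%:R))%:E.
Proof.
rewrite /uniform_on /mscale/= /msum.
under eq_bigr do rewrite /= diracE.
rewrite sumEFin -EFinM mulrC; congr ((_ * _)%:E).
rewrite -(big_mkord xpredT (fun i => (S (nth t0 (enum T) i) \in E)%:R)).
by rewrite cardE -(big_nth t0 xpredT (fun t => (S t \in E)%:R)) big_enum.
Qed.

Let T_gt0 : (0 < #|T|)%N. Proof. by apply/card_gt0P; exists t0. Qed.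

Lemma uniform_on_setT : uniform_on setT = 1%E.
Proof.
rewrite uniform_onE (eq_avg (g := fun=> 1)) => [|t]; last by rewrite in_setT.
by rewrite avg_cst ?T_gt0.
Qed.

HB.instance Definition _ :=
  Measure_isProbability.Build _ _ _ uniform_on uniform_on_setT.

Lemma uniform_on_ge (E : set X) c :
  avg (fun t => (~~ `[< E (S t) >])%:R) <= c -> ((1 - c)%:E <= uniform_on E)%E.
Proof.
move=> Ec; rewrite uniform_onE lee_fin lerBlDr -lerBlDl.
apply: le_trans Ec; rewrite -{1}(avg_cst T_gt0 (1 : R)) -avgB.
apply: ler_avg => t; rewrite (_ : (S t \in E) = `[< E (S t) >]).
  by case: asboolP; rewrite ?subrr ?subr0.
by apply/idP/asboolP; rewrite inE.
Qed.

Lemma ae_uniform_on (P : set X) : (forall x : X, measurable [set x]) ->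
  (forall t, P (S t)) -> {ae uniform_on, forall x, P x}.
Proof.
move=> point_meas PS; exists (~` \bigcup_(t in [set: T]) [set S t]); split.
- by apply: measurableC; apply: fin_bigcup_measurable => [|t _];
    [exact: finite_finset | exact: point_meas].
- rewrite uniform_onE (eq_avg (g := fun=> 0)) ?avg_cst ?T_gt0// => t.
  by rewrite memNset// => /(_ _); apply; exists t.
- by move=> x /= nP [t _ /= xt]; apply: nP; rewrite xt.
Qed.

End UniformOn.

Section MatrixBorel.
Context (R : realType) (r n : nat).

Lemma closed_borel_mx (E : set 'M[R]_(r, n)) :
  closed E -> measurable (E : set (borel_mx R r n)).
Proof.
move=> clE; rewrite -[E]setCK; apply: measurableC; apply: sub_sigma_algebra.
exact: closed_openC.
Qed.

Lemma continuous_l1norm_mulmx (v : 'cV[R]_n) :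
  continuous (fun S : 'M[R]_(r, n) => l1norm (S *m v)).
Proof.
have -> : (fun S : 'M[R]_(r, n) => l1norm (S *m v)) =
    (fun S => \sum_(i < r) `|\sum_(j < n) S i j * v j ord0|).
  by apply/funext => S; apply: eq_bigr => i _; rewrite mxE.
apply: continuous_big => [|i _]; first exact: add_continuous.
move=> S; apply: continuous_comp; last exact: norm_continuous.
apply: continuous_big => [|j _]; first exact: add_continuous.
move=> N; apply: continuousM; first exact: coord_continuous.
exact: cst_continuous.
Qed.

Lemma measurable_l1_embeds d (eps : R) (A : 'M[R]_(n, d)) :
  measurable ([set S | l1_embeds eps A S] : set (borel_mx R r n)).
Proof.
apply: closed_borel_mx.
pose norm_at x (S : 'M[R]_(r, n)) := l1norm (S *m (A *m x)).
have -> : [set S | l1_embeds eps A S] = \bigcap_(x in [set: 'cV[R]_d])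
    (norm_at x @^-1` [set y | (1 - eps) * l1norm (A *m x) <= y] `&`
     norm_at x @^-1` [set y | y <= (1 + eps) * l1norm (A *m x)]).
  apply/seteqP; split=> [S /= embeds x _|S /= embeds x].
    by have [lo hi] := embeds x; rewrite /norm_at /= mulmxA.
  by have [] := embeds x I; rewrite /norm_at /= mulmxA.
apply: closed_bigI => x _; apply: closedI; apply: preimage_closed.
- by move=> S _; exact: continuous_l1norm_mulmx.
- exact: closed_ge.
- by move=> S _; exact: continuous_l1norm_mulmx.
- exact: closed_le.
Qed.

End MatrixBorel.

Lemma exists_l1_embedding_law (R : realType) (r n d : nat) (eps delta s : R)
    (T : finType) (S : T -> 'M[R]_(r, n)) :
  (0 < #|T|)%N -> (forall t, col_sparse s (S t)) ->
  (forall A : 'M[R]_(n, d),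
    avg (fun t => (~~ `[< l1_embeds eps A (S t) >])%:R) <= delta) ->
  exists mu : probability (borel_mx R r n) R,
    {ae mu, forall S, col_sparse s S} /\
    forall A : 'M[R]_(n, d),
      measurable ([set S | l1_embeds eps A S] : set (borel_mx R r n)) /\
      ((1 - delta)%:E <= mu [set S | l1_embeds eps A S])%E.
Proof.
move=> /card_gt0P[t0 _] sparse embeds.
exists (uniform_on R t0 (S : T -> borel_mx R r n)); split=> [|A].
  apply: ae_uniform_on sparse => M; apply: closed_borel_mx.
  exact/accessible_closed_set1/hausdorff_accessible/norm_hausdorff.
by split; [exact: measurable_l1_embeds | exact: uniform_on_ge (embeds A)].
Qed.

(** * Choice of the parameters *)

Lemma eval4_size_poly (R : realType) (c : R) (m : nat) : exists p : poly4 R,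
  forall a b e l, eval4 p a b e l = (c * a ^+ 2 * b * e * (l + 2)) ^+ m.
Proof.
pose X (i : 'I_4) : mpoly.mpoly 4 R := mpoly.mpolyX R (mpoly.mnm1 i).
pose C (y : R) : mpoly.mpoly 4 R := mpoly.mpolyC 4 y.
exists ((C c * X (inord 0) ^+ 2 * X (inord 1) * X (inord 2)
  * (X (inord 3) + C 2)) ^+ m).
move=> a b e l.
rewrite /eval4 (rmorphXn (mpoly.meval _))/= !mpoly.mevalM mpoly.mevalD.
rewrite !mpoly.mevalC !mpoly.mevalXU.
by rewrite !(tnth_nth 0) !inordK.
Qed.

Lemma expR1_le4 (R : realType) : expR 1 <= 4 :> R.
Proof.
have half_ge : 2^-1 <= expR (- 2^-1) :> R.
  by have := @expR_ge1Dx R (- 2^-1); lra.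
have : expR (2^-1) <= 2 :> R.
  by rewrite -[leRHS]invrK -[leLHS]invrK -expRN lef_pV2 ?posrE ?expR_gt0.
rewrite (_ : expR 1 = expR 2^-1 ^+ 2); last first.
  by rewrite expr2 -expRD; congr expR; lra.
by have := expR_gt0 (2^-1 : R); nra.
Qed.

Lemma ln_natr_ge0 (R : realType) (n : nat) : 0 <= ln n%:R :> R.
Proof. by case: n => [|n]; [rewrite ln0 | rewrite ln_ge0// ler1n]. Qed.

Lemma leq_exp_truncn_ln (R : realType) (n W : nat) : (4 <= W)%N ->
  (n <= W ^ (Num.truncn (ln n%:R : R)).+1)%N.
Proof.
move=> W_ge4; case: n => [//|n]; set H := (Num.truncn _).+1.
have /andP[_ ln_lt] := truncn_itv (ln_natr_ge0 R n.+1).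
rewrite -(ler_nat R) natrX -[n.+1%:R]lnK ?posrE ?ltr0n//.
apply: le_trans (_ : expR (H%:R * 1) <= _); first by rewrite ler_expR mulr1 ltW.
rewrite expRM_natl lerXn2r ?nnegrE ?expR_ge0// (le_trans (expR1_le4 R))//.
by rewrite ler_nat.
Qed.

Lemma sketch_size_le (R : realType) (L y : R) (W K h m : nat) :
  1 <= y -> (0 < h <= W)%N -> K.+1%:R <= m%:R * y -> W%:R <= L ->
  (h * W ^ K)%N%:R <= (L ^+ m) `^ y.
Proof.
move=> y_ge1 /andP[h_gt0 hW] Ky WL.
have W_ge1 : 1 <= W%:R :> R by rewrite ler1n (leq_trans h_gt0).
apply: (@le_trans _ _ (W%:R `^ K.+1%:R)).
  by rewrite powR_mulrn// -natrX ler_nat expnS leq_mul2r hW orbT.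
apply: (@le_trans _ _ (W%:R `^ (m%:R * y))); first by rewrite ler_powR.
rewrite powRrM powR_mulrn//.
apply: ge0_ler_powR; rewrite ?nnegrE ?exprn_ge0//; try lra.
by rewrite lerXn2r ?nnegrE//; lra.
Qed.

Lemma sketch_parameters (R : realType) (n d : nat) (eps delta : R) :
  (0 < d)%N -> 0 < eps < 1 -> 0 < delta < 1 ->
  exists H W K : nat,
    [/\ (1 < W)%N, (0 < K)%N, (n <= W ^ H)%N & H.+1%:R <= ln n%:R + 2 :> R] /\
    [/\ 30 * d%:R ^+ 2 * H.+1%:R / (eps * delta) <= W%:R,
        36 * d%:R / (eps * delta) <= K%:R &
        (H.+1 * W ^ K)%N%:R
        <= ((31 * d%:R ^+ 2 * eps^-1 * delta^-1 * (ln n%:R + 2)) ^+ 38)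
           `^ (d%:R / (delta * eps))].
Proof.
move=> d_gt0 /andP[eps_gt0 eps_lt1] /andP[delta_gt0 delta_lt1].
have epsdelta_gt0 : 0 < eps * delta by rewrite mulr_gt0.
have epsdelta_le1 : eps * delta <= 1 by rewrite mulr_ile1// ltW.
pose y : R := d%:R / (eps * delta).
have y_ge1 : 1 <= y.
  by rewrite ler_pdivlMr// mul1r (le_trans epsdelta_le1)// ler1n.
pose H := (Num.truncn (ln n%:R : R)).+1.
have H_le : H.+1%:R <= ln n%:R + 2 :> R.
  by have /andP[] := truncn_itv (ln_natr_ge0 R n); rewrite -!natr1; lra.
pose Q : R := d%:R ^+ 2 * H.+1%:R / (eps * delta).
have HQ : H.+1%:R <= Q.
  rewrite ler_pdivlMr// (@le_trans _ _ H.+1%:R)// ?ler_piMr//.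
  by rewrite ler_peMl ?exprn_ege1 ?ler1n.
have Q_ge1 : 1 <= Q by rewrite (le_trans _ HQ) ?ler1n.
have Q_ge0 : 0 <= 30 * Q by lra.
have y_ge0 : 0 <= 36 * y by lra.
pose W := (Num.truncn (30 * Q)).+1; pose K := (Num.truncn (36 * y)).+1.
have [W_le W_gt] : W%:R <= 31 * Q /\ 30 * Q < W%:R.
  by have /andP[] := truncn_itv Q_ge0; rewrite /W -!natr1; split; lra.
have [K_le K_gt] : K.+1%:R <= 38 * y /\ 36 * y < K%:R.
  by have /andP[] := truncn_itv y_ge0; rewrite /K -!natr1; split; lra.
have W_ge4 : (4 <= W)%N by rewrite -(ler_nat R); lra.
exists H, W, K; split; split=> //.
- exact: ltn_trans W_ge4.
- exact: leq_exp_truncn_ln.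
- suff -> : 30 * d%:R ^+ 2 * H.+1%:R / (eps * delta) = 30 * Q by exact: ltW.
  by rewrite /Q; ring.
- by rewrite -mulrA ltW.
rewrite [delta * eps]mulrC; apply: sketch_size_le y_ge1 _ K_le _.
  by rewrite /= -(ler_nat R); lra.
apply: le_trans W_le _.
have -> : 31 * d%:R ^+ 2 * eps^-1 * delta^-1 * (ln n%:R + 2)
    = 31 * (d%:R ^+ 2 * (ln n%:R + 2) / (eps * delta)).
  by field; rewrite !gt_eqF.
rewrite ler_wpM2l// ler_wpM2r ?invr_ge0 ?(ltW epsdelta_gt0)//.
by rewrite ler_wpM2l ?exprn_ge0.
Qed.

Theorem theorem3p1 (R : realType) :
  exists (p : poly4 R) (q : {poly R}),
  forall (eps delta : R) (n d : nat),
    0 < eps < 1 -> 0 < delta < 1 ->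
    exists r : nat,
      r%:R <= eval4 p d%:R eps^-1 delta^-1 (ln n%:R) `^ (d%:R / (delta * eps))
      /\
      exists mu : probability (borel_mx R r n) R,
        {ae mu, forall S, col_sparse q.[ln n%:R] S} /\
        forall A : 'M[R]_(n, d),
          measurable ([set S | l1_embeds eps A S] : set (borel_mx R r n)) /\
          ((1 - delta)%:E <= mu [set S | l1_embeds eps A S])%E.
Proof.
have [p pE] := @eval4_size_poly R 31 38.
exists p, ('X + 2%:P) => eps delta n d eps01 delta01.
have [delta_gt0 _] := andP delta01; rewrite pE hornerD hornerX hornerC.
have [->|d_gt0] := posnP d.
  exists 0%N; split; first exact: powR_ge0.
  apply: (exists_l1_embedding_law (T := unit) (S := fun=> 0)) => [|_ j|A].
  - by rewrite card_unit.
  - by rewrite eq_card0 ?addr_ge0 ?ln_natr_ge0//; case.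
  - rewrite (eq_avg (g := fun=> 0)) ?avg_cst ?card_unit ?ltW// => t.
    by rewrite asboolT//; exact: l1_embeds_no_column.
have [H [W [K [[W_gt1 K_gt0 nW H_le] [W_ge K_ge size_le]]]]] :=
  sketch_parameters n d_gt0 eps01 delta01.
exists (H.+1 * W ^ K)%N; split=> //.
apply: (exists_l1_embedding_law (T := ('I_K * {ffun 'I_n -> coin W K H})%type)
  (S := fun t => sketch_mx R W_gt1 t.1 t.2)) => [|t j|A].
- by rewrite card_prod card_ord muln_gt0 K_gt0 card_ffun_gt0 ?coin_gt0.
- exact: le_trans (col_sparse_sketch_mx _ _ _ _ _) H_le.
- exact: avg_sketch_mx_failure_le.
Qed.
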